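(* Let $\tau$ be a substitution on $\mathcal A=\{0,1,\ldots,n-1\}$ satisfying the standing assumptions below, having exactly $m$ right-infinite fixed points $p_1,\ldots,p_m$, where $p_i$ is a $k_i$-branch point, and no other branch points. Suppose $\mathcal L_\tau$ has exactly $N$ words of length $2$. Then there exists a substitution $\tau'$ on an $N$-letter alphabet $\mathcal A'$ such that: (1) $(X_\tau,\sigma)$ is topologically conjugate to $(X_{\tau'},\sigma)$; (2) $\tau'$ has $m$ right-infinite fixed points $\mathbf m_1,\ldots,\mathbf m_m$; (3) $\tau'$ has $\sum_{i=1}^m k_i$ left-infinite fixed points; (4) the Vershik map $V_{\tau'}$ on $\mathcal B_{\tau'}$ extends to a continuous map $X_{\mathcal B_{\tau'}}\to X_{\mathcal B_{\tau'}}$; and (5) $(X_{\tau'},\sigma)$ is topologically conjugate to $(X_{\mathcal B_{\tau'}},V_{\tau'})$.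
   Context: Substitutions are extended to words and sequences by concatenation; $\sigma$ is the left shift; $X_\theta\subset\mathcal A^{\mathbb N}$ is the closure of the shift orbit of a generating fixed point of $\theta$, $\mathcal L_\theta$ the set of subwords of the words $\theta^j(a)$. A right-infinite fixed point is $x\in\mathcal A^{\mathbb N}$ with $\theta(x)=x$; a left-infinite fixed point is a left-infinite sequence $\ldots x_{-2}x_{-1}$ with $\theta(\ldots x_{-2}x_{-1})=\ldots x_{-2}x_{-1}$. A branch point of $X_\theta$ is a point with more than one preimage under $\sigma:X_\theta\to X_\theta$; a $k$-branch point has exactly $k$ preimages. Standing assumptions: $\tau$ primitive, $X_\tau$ infinite, $\tau$ unilaterally recognizable (with $u$ a fixed point and $E=\{0\}\cup\{|\tau(u_0\cdots u_{p-1})|:p>0\}$, there is $L$ such that $u_{[i,i+L-1]}=u_{[j,j+L-1]}$ and $i\in E$ imply $j\in E$), all powers of $\tau$ injective on letters. $\mathcal B_{\tau'}$ is the stationary ordered Bratteli diagram of $\tau'$: $V_0=\{v_0\}$, $V_j=\mathcal A'$ for $j\ge1$, one edge from $v_0$ to each vertex of $V_1$, and for $j\ge2$ the edges into $a\in V_j$, in increasing order, have as sources in $V_{j-1}$ the successive letters of $\tau'(a)$. $X_{\mathcal B_{\tau'}}$ is the space of infinite paths with the product topology. For non-maximal $x$ (some edge not maximal among edges with the same range), with $k$ least such that $x_k$ is not maximal and $y_k$ its successor, $V_{\tau'}(x)=(z_1,\ldots,z_{k-1},y_k,x_{k+1},\ldots)$ where $z_1\cdots z_{k-1}$ is the unique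 minimal path from $v_0$ to $s(y_k)$. *)

(* Defs.v *)
From mathcomp Require Import all_boot.
From Stdlib Require List.
Set Implicit Arguments.
Unset Strict Implicit.
Unset Printing Implicit Defensive.

Definition subst (n : nat) := 'I_n -> seq 'I_n.

Definition nonerasing n (t : subst n) := forall a, 0 < size (t a).

Definition subst_word n (t : subst n) (w : seq 'I_n) : seq 'I_n :=
  flatten (map t w).

Definition subst_pow n (t : subst n) (j : nat) (a : 'I_n) : seq 'I_n :=
  iter j (subst_word t) [:: a].

Definition primitive n (t : subst n) :=
  exists k, 0 < k /\ forall a b : 'I_n, b \in subst_pow t k a.

Definition injective_powers n (t : subst n) :=
  forall j, injective (subst_pow t j).

Definition lang n (t : subst n) (w : seq 'I_n) :=
  exists j a, infix w (subst_pow t j a).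

Definition shift {A : Type} (x : nat -> A) : nat -> A := fun i => x i.+1.

(* extension to right-infinite sequences: theta(x_0 x_1 ...) = theta(x_0)theta(x_1)...
   (letter i of theta(x) is letter i of theta(x_0...x_i), which has length > i
   for a non-erasing theta) *)
Definition subst_right n (t : subst n) (x : nat -> 'I_n) : nat -> 'I_n :=
  fun i => nth (x 0) (subst_word t (mkseq x i.+1)) i.

Definition right_fixed n (t : subst n) (x : nat -> 'I_n) := subst_right t x = x.

(* a left-infinite sequence ... x_{-2} x_{-1} is encoded as y with y i = x_{-(i+1)};
   theta(... x_{-2} x_{-1}) = ... theta(x_{-2}) theta(x_{-1}) *)
Definition subst_left n (t : subst n) (y : nat -> 'I_n) : nat -> 'I_n :=
  fun i => nth (y 0) (rev (subst_word t (rev (mkseq y i.+1)))) i.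

Definition left_fixed n (t : subst n) (y : nat -> 'I_n) := subst_left t y = y.

Definition in_orbit_closure {A : Type} (u x : nat -> A) :=
  forall l, exists k, forall i, i < l -> x i = u (k + i).

Definition Xsub n (t : subst n) (x : nat -> 'I_n) :=
  exists u, right_fixed t u /\ in_orbit_closure u x.

Definition infinite_set {A : Type} (X : (nat -> A) -> Prop) :=
  ~ exists l : list (nat -> A), forall x, X x -> List.In x l.

Definition Eset n (t : subst n) (u : nat -> 'I_n) (i : nat) :=
  i = 0 \/ exists p, 0 < p /\ i = size (subst_word t (mkseq u p)).

Definition unilat_recognizable n (t : subst n) :=
  forall u, right_fixed t u ->
  exists L, forall i j,
    mkseq (fun s => u (i + s)) L = mkseq (fun s => u (j + s)) L ->
    Eset t u i -> Eset t u j.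

Definition branch_point {A : Type} (X : (nat -> A) -> Prop) (x : nat -> A) :=
  X x /\ exists y1 y2, X y1 /\ X y2 /\ y1 <> y2 /\ shift y1 = x /\ shift y2 = x.

Definition k_branch_point {A : Type} (X : (nat -> A) -> Prop) (x : nat -> A) (k : nat) :=
  branch_point X x /\
  exists ys : list (nat -> A), List.NoDup ys /\ List.length ys = k /\
    forall y, List.In y ys <-> (X y /\ shift y = x).

(* continuity on X (relative product topology, discrete factors):
   cylinders form a base of the product topology *)
Definition cont_on {A B : Type} (X : (nat -> A) -> Prop)
  (f : (nat -> A) -> (nat -> B)) :=
  forall x, X x -> forall l, exists l', forall y, X y ->
    (forall i, i < l' -> y i = x i) -> forall i, i < l -> f y i = f x i.

Definition topo_conj {A B : Type} (X : (nat -> A) -> Prop) (f : (nat -> A) -> (nat -> A))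
  (Y : (nat -> B) -> Prop) (g : (nat -> B) -> (nat -> B)) :=
  exists (phi : (nat -> A) -> (nat -> B)) (psi : (nat -> B) -> (nat -> A)),
    (forall x, X x -> Y (phi x)) /\ (forall y, Y y -> X (psi y)) /\
    (forall x, X x -> psi (phi x) = x) /\ (forall y, Y y -> phi (psi y) = y) /\
    cont_on X phi /\ cont_on Y psi /\
    (forall x, X x -> phi (f x) = g (phi x)).

(* Stationary ordered Bratteli diagram of t : subst N.
   Edge at index 0 of a path: the edge v0 -> (x 0).1 in V_1 (second comp. 0).
   Edge at index j >= 1: the ((x j).2)-th edge (0-based, in increasing order)
   into the vertex (x j).1 of V_{j+1}; its source in V_j is the letter
   nth (t (x j).1) (x j).2. *)
Definition edge (N : nat) := ('I_N * nat)%type.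

Definition bpath N (t : subst N) (x : nat -> edge N) :=
  (x 0).2 = 0 /\
  forall j, (x j.+1).2 < size (t (x j.+1).1) /\
            nth (x j).1 (t (x j.+1).1) (x j.+1).2 = (x j).1.

(* the edge at index j is not maximal among edges with the same range
   (the edges at index 0 are the unique edges into their range) *)
Definition nonmax_at N (t : subst N) (x : nat -> edge N) j :=
  0 < j /\ (x j).2.+1 < size (t (x j).1).

Definition nonmaximal N (t : subst N) (x : nat -> edge N) :=
  exists j, nonmax_at t x j.

Definition vershik_rel N (t : subst N) (x y : nat -> edge N) :=
  exists k, nonmax_at t x k /\ (forall j, j < k -> ~ nonmax_at t x j) /\
    y k = ((x k).1, (x k).2.+1) /\
    (forall j, k < j -> y j = x j) /\
    (forall j, j < k -> (y j).2 = 0) /\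
    bpath t y.

(* Main.v *)
(** Write [theta] for a power [tau^J] for which the map "last letter of the image"
    is idempotent. By recognizability, injectivity on letters and the hypothesis
    that branch points are fixed, every point of [X = Xsub tau] is
    [sigma^e (theta z)] with [e < |theta (z 0)|] for a unique [(z, e)]. Applied to
    the preimages of a fixed point [p i] this makes the last-letter map injective,
    hence the identity, on the letters that can precede [p i]; so each preimage of
    [p i] gives a left-infinite fixed point of [theta].

    But [theta] may have right-infinite fixed points that [tau] permutes without
    fixing. They are not branch points, so the left boundary of the block
    [theta b], for [b] not the first letter of some [p i], may be moved to the
    right, to an occurrence of the first letter of a fixed point of [tau], without
    losing unique desubstitution: this leaves exactly the [p i]. The substitution
    [tau'] is this modified [theta] written on two-letter words, so that a maximal
    path in the Bratteli diagram, which only records one letter of a point, also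
    determines the next one. *)
Require Import Defs.
From mathcomp Require Import all_boot zify.
From Stdlib Require List.
From Stdlib Require Import Classical FunctionalExtensionality PropExtensionality IndefiniteDescription.
Set Implicit Arguments.
Unset Strict Implicit.
Unset Printing Implicit Defensive.

(** * Sequences and substitutions *)

Definition sh {A} k (x : nat -> A) : nat -> A := fun i => x (k + i).

(* The default value of [nth] supplies the tail. *)
Definition scat {A} (w : seq A) (x : nat -> A) : nat -> A :=
  fun i => nth (x (i - size w)) w i.

Section Sequences.
Variable A : Type.
Implicit Types (x y : nat -> A) (w v : seq A).

Lemma shiftE x : shift x = sh 1 x. Proof. by []. Qed.

Lemma sh0 x : sh 0 x = x. Proof. by []. Qed.

Lemma shD k l x : sh k (sh l x) = sh (l + k) x.
Proof. by apply: functional_extensionality => i; rewrite /sh addnA. Qed.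

Lemma scat0 x : scat [::] x = x.
Proof. by apply: functional_extensionality => i; rewrite /scat nth_nil subn0. Qed.

Lemma scat_lt d w x i : i < size w -> scat w x i = nth d w i.
Proof. by move=> lt_i; apply: set_nth_default. Qed.

Lemma scat_ge w x i : size w <= i -> scat w x i = x (i - size w).
Proof. by move=> le_i; rewrite /scat nth_default. Qed.

Lemma scat_cat w v x : scat (w ++ v) x = scat w (scat v x).
Proof.
apply: functional_extensionality => i; rewrite /scat nth_cat size_cat subnDA.
case: ltnP => [lt_i|le_i]; first exact: set_nth_default.
by rewrite [RHS]nth_default.
Qed.

Lemma sh_scat k w x : k <= size w -> sh k (scat w x) = scat (drop k w) x.
Proof.
move=> le_k; apply: functional_extensionality => i.
rewrite /sh /scat nth_drop size_drop; congr (nth (x _) _ _); lia.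
Qed.

Lemma sh_scat_size w x : sh (size w) (scat w x) = x.
Proof. by rewrite sh_scat // drop_size scat0. Qed.

Lemma mkseqD x k l : mkseq x (k + l) = mkseq x k ++ mkseq (sh k x) l.
Proof.
rewrite /mkseq iotaD map_cat; congr cat.
by rewrite add0n -[k in iota k]addn0 iotaDl -map_comp.
Qed.

Lemma scat_mkseq x k : scat (mkseq x k) (sh k x) = x.
Proof.
apply: functional_extensionality => i.
rewrite /scat /sh size_mkseq; case: (ltnP i k) => [lt_i|le_i].
  by rewrite nth_mkseq.
by rewrite nth_default ?size_mkseq // subnKC.
Qed.

Lemma mkseq_scat w x : mkseq (scat w x) (size w) = w.
Proof.
case: w => [//|a w]; apply: (@eq_from_nth _ a); first by rewrite size_mkseq.
by move=> i; rewrite size_mkseq => lt_i; rewrite nth_mkseq // (scat_lt a).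
Qed.

Lemma mkseq_scat_take w x k : k <= size w -> mkseq (scat w x) k = take k w.
Proof.
move=> le_k; rewrite -[in RHS](mkseq_scat w x) -(subnKC le_k) mkseqD.
by rewrite take_size_cat ?size_mkseq.
Qed.

Lemma scat_inj w v x y :
  size w = size v -> scat w x = scat v y -> w = v /\ x = y.
Proof.
move=> eq_sz eq_c; split; first by rewrite -(mkseq_scat w x) eq_c eq_sz mkseq_scat.
by rewrite -(sh_scat_size w x) eq_c eq_sz sh_scat_size.
Qed.

Lemma eq_mkseqP x y l : mkseq x l = mkseq y l <-> forall i, i < l -> x i = y i.
Proof.
split=> [eq_m i lt_i | eq_i]; last first.
  by apply/eq_in_map => i; rewrite mem_iota add0n => /eq_i.
by rewrite -(nth_mkseq (x 0) x lt_i) eq_m nth_mkseq.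
Qed.

End Sequences.

Section Substitutions.
Variables (n : nat) (t : subst n).
Implicit Types (x y : nat -> 'I_n) (w v : seq 'I_n).

Lemma subst_word_cat w v : subst_word t (w ++ v) = subst_word t w ++ subst_word t v.
Proof. by rewrite /subst_word map_cat flatten_cat. Qed.

Lemma subst_word1 a : subst_word t [:: a] = t a.
Proof. by rewrite /subst_word /= cats0. Qed.

Lemma subst_word_mkseqD x k l :
  subst_word t (mkseq x (k + l)) =
  subst_word t (mkseq x k) ++ subst_word t (mkseq (sh k x) l).
Proof. by rewrite mkseqD subst_word_cat. Qed.

Lemma size_subst_word c w : (forall a, c <= size (t a)) ->
  c * size w <= size (subst_word t w).
Proof.
move=> t_c; elim: w => [|a w IH]; first by rewrite muln0.
by rewrite -cat1s subst_word_cat subst_word1 !size_cat mulnDr muln1 leq_add.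
Qed.

Lemma infix_subst_word w v : infix w v -> infix (subst_word t w) (subst_word t v).
Proof.
case/infixP => s1 [s2 ->]; apply/infixP.
by exists (subst_word t s1), (subst_word t s2); rewrite !subst_word_cat.
Qed.

Lemma subst_word_pow j w : iter j (subst_word t) w = subst_word (subst_pow t j) w.
Proof.
elim: j w => [|j IH] w.
  by rewrite /= /subst_word /subst_pow /=; elim: w => //= a w {1}->.
rewrite /= IH /subst_word; elim: w => //= a w.
by rewrite map_cat flatten_cat => ->.
Qed.

Lemma subst_powS j a : subst_pow t j.+1 a = subst_word t (subst_pow t j a).
Proof. by []. Qed.

Lemma subst_powD i j a :
  subst_pow t (i + j) a = subst_word (subst_pow t i) (subst_pow t j a).
Proof. by rewrite /subst_pow iterD subst_word_pow. Qed.

Lemma lang_infix w v : infix w v -> lang t v -> lang t w.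
Proof. by move=> wv [j [a va]]; exists j, a; apply: infix_trans va. Qed.

Lemma lang_subst_word w : lang t w -> lang t (subst_word t w).
Proof. by move=> [j [a /infix_subst_word wa]]; exists j.+1, a. Qed.

Lemma lang_mkseq_leq x k l : k <= l -> lang t (mkseq x l) -> lang t (mkseq x k).
Proof.
move=> le_kl; apply: lang_infix; rewrite -(subnKC le_kl) mkseqD.
exact: prefix_infix.
Qed.

Lemma lang_mkseq_sh x k l :
  lang t (mkseq x (k + l)) -> lang t (mkseq (sh k x) l).
Proof. apply: lang_infix; rewrite mkseqD; exact: suffix_infix. Qed.

Lemma subst_right_agree x y k :
  (forall i, i <= k -> x i = y i) -> subst_right t x k = subst_right t y k.
Proof.
by move=> exy; rewrite /subst_right; rewrite (_ : mkseq x k.+1 = mkseq y k.+1) ?exy //; apply/eq_mkseqP.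
Qed.

Hypothesis t_gt0 : nonerasing t.

Lemma leq_size_subst_word w : size w <= size (subst_word t w).
Proof. by rewrite -[size w]mul1n size_subst_word. Qed.

Lemma subst_word_prefix_mono x k l :
  size (subst_word t (mkseq x k)) <= size (subst_word t (mkseq x l)) -> k <= l.
Proof.
move=> le_s; rewrite leqNgt; apply/negP => lt_lk; move: le_s.
rewrite -(subnKC lt_lk) addSn -addnS subst_word_mkseqD size_cat.
have := leq_size_subst_word (mkseq (sh l x) (k - l.+1).+1).
rewrite size_mkseq; lia.
Qed.

Lemma nth_subst_right d x k i : i < size (subst_word t (mkseq x k)) ->
  subst_right t x i = nth d (subst_word t (mkseq x k)) i.
Proof.
move=> lt_i; rewrite /subst_right.
have lt_i' : i < size (subst_word t (mkseq x i.+1)).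
  by rewrite (leq_trans _ (leq_size_subst_word _)) // size_mkseq.
rewrite (set_nth_default d) //.
case: (leqP i.+1 k) => [le_ik|/ltnW le_ki].
  by rewrite -(subnKC le_ik) subst_word_mkseqD nth_cat lt_i'.
by rewrite -(subnKC le_ki) subst_word_mkseqD nth_cat lt_i.
Qed.

Lemma subst_rightE k x :
  subst_right t x = scat (subst_word t (mkseq x k)) (subst_right t (sh k x)).
Proof.
apply: functional_extensionality => i.
case: (ltnP i (size (subst_word t (mkseq x k)))) => [lt_i|le_i].
  by rewrite (scat_lt (x 0)) // (nth_subst_right (x 0) lt_i).
rewrite scat_ge // (@nth_subst_right (x 0) _ (k + i.+1)); last first.
  rewrite (leq_trans _ (leq_size_subst_word _)) // size_mkseq; lia.
rewrite subst_word_mkseqD nth_cat ltnNge le_i /=.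
apply/esym/nth_subst_right.
rewrite (leq_trans _ (leq_size_subst_word _)) // size_mkseq; lia.
Qed.

Lemma subst_right1 x : subst_right t x = scat (t (x 0)) (subst_right t (sh 1 x)).
Proof. by rewrite (subst_rightE 1) /mkseq /= subst_word1. Qed.

Lemma subst_right_scat w x :
  subst_right t (scat w x) = scat (subst_word t w) (subst_right t x).
Proof. by rewrite (subst_rightE (size w)) mkseq_scat sh_scat_size. Qed.

Lemma mkseq_subst_right x k :
  mkseq (subst_right t x) (size (subst_word t (mkseq x k))) =
  subst_word t (mkseq x k).
Proof. by rewrite (subst_rightE k) mkseq_scat. Qed.

Lemma sh_subst_right x k :
  sh (size (subst_word t (mkseq x k))) (subst_right t x) = subst_right t (sh k x).
Proof. by rewrite (subst_rightE k) sh_scat_size. Qed.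

(** Blocks are nonempty, so unrolling the recursion for [R] [i.+1] times exposes letter [i]: the
    recursion has one solution. The predicate [P] admits recursions that hold only on a
    shift-invariant set. *)
Lemma subst_right_coind A (P : (nat -> A) -> Prop)
    (h : (nat -> A) -> nat -> 'I_n) (R : (nat -> A) -> nat -> 'I_n) :
  (forall z, P z -> P (sh 1 z)) ->
  (forall z, P z -> h (sh 1 z) = sh 1 (h z)) ->
  (forall z, P z -> R z = scat (t (h z 0)) (R (sh 1 z))) ->
  forall z, P z -> subst_right t (h z) = R z.
Proof.
move=> P1 h1 R1 u Pu.
have RE k z : P z -> R z = scat (subst_word t (mkseq (h z) k)) (R (sh k z)).
  elim: k z => [|k IH] z Pz; first by rewrite scat0.
  rewrite R1 // (IH (sh 1 z)); last exact: P1.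
  by rewrite -scat_cat shD h1 // -[k.+1]add1n subst_word_mkseqD /mkseq /= subst_word1.
apply: functional_extensionality => i.
have lt_i : i < size (subst_word t (mkseq (h u) i.+1)).
  by rewrite (leq_trans _ (leq_size_subst_word _)) // size_mkseq.
by rewrite (RE i.+1) // (nth_subst_right (h u 0) lt_i) (scat_lt (h u 0)).
Qed.

Lemma locate x e : exists k r,
  r < size (t (x k)) /\ e = size (subst_word t (mkseq x k)) + r.
Proof.
elim: e => [|e [k [r [lt_r ->]]]]; first by exists 0, 0.
case: (ltnP r.+1 (size (t (x k)))) => [lt_r1|le_r1].
  by exists k, r.+1; rewrite addnS.
exists k.+1, 0; split=> //.
rewrite -[k.+1]addn1 subst_word_mkseqD size_cat addn0 /mkseq /= subst_word1 /sh addn0.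
lia.
Qed.

End Substitutions.

Lemma subst_right_comp n (t1 t2 t : subst n) x :
  nonerasing t1 -> nonerasing t2 -> (forall a, t a = subst_word t1 (t2 a)) ->
  subst_right t x = subst_right t1 (subst_right t2 x).
Proof.
move=> t1_gt0 t2_gt0 tE.
have t_gt0 : nonerasing t.
  by move=> a; rewrite tE (leq_trans (t2_gt0 a)) // leq_size_subst_word.
apply: (@subst_right_coind _ t t_gt0 _ (fun _ => True) id
  (fun x => subst_right t1 (subst_right t2 x))) => // {}x _.
by rewrite [in LHS](subst_right1 t2_gt0) subst_right_scat // tE.
Qed.

Lemma nonerasing_pow n (t : subst n) j : nonerasing t -> nonerasing (subst_pow t j).
Proof.
move=> t_gt0; elim: j => [|j IH] a //.
by rewrite subst_powS (leq_trans (IH a)) // leq_size_subst_word.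
Qed.

Lemma subst_right_powS n (t : subst n) j x : nonerasing t ->
  subst_right (subst_pow t j.+1) x = subst_right t (subst_right (subst_pow t j) x).
Proof. by move=> t_gt0; apply: subst_right_comp => //; apply: nonerasing_pow. Qed.

Lemma subst_right_pow0 n (t : subst n) x : subst_right (subst_pow t 0) x = x.
Proof.
have id_gt0 : nonerasing (subst_pow t 0) by [].
apply: (@subst_right_coind _ _ id_gt0 _ (fun _ => True) id id) => // y _.
by rewrite -[LHS](scat_mkseq _ 1).
Qed.

Lemma right_fixed_pow n (t : subst n) j x : nonerasing t ->
  right_fixed t x -> right_fixed (subst_pow t j) x.
Proof.
move=> t_gt0 fix_x; elim: j => [|j IH]; first exact: subst_right_pow0.
by rewrite /right_fixed subst_right_powS // IH.
Qed.

(** * Compactness and unique desubstitution *)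

Lemma nat_pigeonhole (A : finType) (P : nat -> Prop) (g : nat -> A) :
  (forall M, exists l, M <= l /\ P l) ->
  exists a, forall M, exists l, [/\ M <= l, P l & g l = a].
Proof.
move=> infP; apply: NNPP => no_a.
have bnd a : exists M, forall l, M <= l -> P l -> g l <> a.
  apply: NNPP => no_M; apply: no_a; exists a => M.
  apply: NNPP => no_l; apply: no_M; exists M => l le_l Pl gl.
  by apply: no_l; exists l.
have [b bP] := functional_choice _ bnd.
have [l [le_l Pl]] := infP (\max_a b a).
by apply: (bP (g l) l) => //; apply: leq_trans le_l; apply: leq_bigmax.
Qed.

(** König's argument: a word that begins infinitely many of the sequences extends by one letter to
    another such word. The bound [M] makes the index [l] as large as wanted. *)
Lemma cluster_point (A : finType) (xs : nat -> nat -> A) :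
  exists z, forall L M, exists l, M <= l /\ forall i, i < L -> xs l i = z i.
Proof.
pose often w := forall M, exists l, M <= l /\ mkseq (xs l) (size w) = w.
have ext w : exists a, often w -> often (rcons w a).
  case: (classic (often w)) => [ow|]; last by exists (xs 0 0).
  have [a aP] := nat_pigeonhole (fun l => xs l (size w)) ow.
  exists a => _ M; have [l [le_l eq_w eq_a]] := aP M.
  exists l; split=> //; rewrite size_rcons /mkseq -addn1 iotaD map_cat.
  by rewrite -/(mkseq _ _) eq_w /= add0n eq_a cats1.
have [nxt nxtP] := functional_choice _ ext.
pose ws k := iter k (fun w => rcons w (nxt w)) [::].
have ws_often k : often (ws k).
  elim: k => [M|k IH]; first by exists M.
  exact: nxtP.
have ws_mkseq k : ws k = mkseq (fun i => nxt (ws i)) k.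
  elim: k => // k IH.
  by rewrite /= IH /mkseq -addn1 iotaD map_cat cats1 -/(mkseq _ _) -IH.
exists (fun i => nxt (ws i)) => L M; have [l [le_l eq_l]] := ws_often L M.
exists l; split=> //; apply/eq_mkseqP.
by rewrite ws_mkseq size_mkseq in eq_l.
Qed.

Definition closed_set {A} (X : (nat -> A) -> Prop) :=
  forall x, (forall L, exists y, X y /\ forall i, i < L -> y i = x i) -> X x.

(** Compactness: points that violate the bound at every level would cluster at some [z] in [X] with
    [phi z = phi x] by continuity, hence [z = x] by injectivity, while they all differ from [x]
    before [L]. *)
Lemma inverse_cont (A : finType) B (X : (nat -> A) -> Prop)
    (phi : (nat -> A) -> nat -> B) :
  closed_set X -> cont_on X phi ->
  (forall x y, X x -> X y -> phi x = phi y -> x = y) ->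
  forall x, X x -> forall L, exists L', forall y, X y ->
    (forall i, i < L' -> phi y i = phi x i) -> forall i, i < L -> y i = x i.
Proof.
move=> clX contf injf x Xx L; apply: NNPP => no_L'.
have bad l : exists y, [/\ X y, forall i, i < l -> phi y i = phi x i &
    ~ forall i, i < L -> y i = x i].
  apply: NNPP => no_y; apply: no_L'; exists l => y Xy eq_y.
  by apply: NNPP => neq; apply: no_y; exists y.
have [ys ysP] := functional_choice _ bad.
have [z zP] := cluster_point ys.
have Xz : X z.
  by apply: clX => l; have [k [_ eq_k]] := zP l 0; exists (ys k); case: (ysP k).
have eq_zx : z = x.
  apply: injf => //; apply: functional_extensionality => i.
  have [l' l'P] := contf z Xz i.+1.
  have [k [lt_k eq_k]] := zP l' i.+1.
  by have [Xk ek _] := ysP k; rewrite -(l'P _ Xk eq_k) // ek.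
have [k [_ eq_k]] := zP L 0.
by have [_ _ []] := ysP k; move=> i lt_i; rewrite eq_k // eq_zx.
Qed.

Lemma cont_comp A B C (X : (nat -> A) -> Prop) (Y : (nat -> B) -> Prop)
    (f : (nat -> A) -> nat -> B) (g : (nat -> B) -> nat -> C) :
  cont_on X f -> (forall x, X x -> Y (f x)) -> cont_on Y g ->
  cont_on X (fun x => g (f x)).
Proof.
move=> cf fXY cg x Xx l.
have [l1 l1P] := cg (f x) (fXY x Xx) l; have [l2 l2P] := cf x Xx l1.
by exists l2 => y Xy eq_y; apply: l1P; [exact: fXY | exact: l2P].
Qed.

Lemma cont_shift A (X : (nat -> A) -> Prop) : cont_on X shift.
Proof. by move=> x _ l; exists l.+1 => y _ eq_y i lt_i; apply: eq_y. Qed.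

(** This is a Kakutani-Rokhlin partition of [X]: every point lies on exactly one floor [e] of the
    tower over the image of the points that begin with [z 0], and has one desubstitution [z]. *)
Definition tower n (t : subst n) (X : (nat -> 'I_n) -> Prop) :=
  (forall y, X y -> exists z e,
     [/\ X z, e < size (t (z 0)) & y = sh e (subst_right t z)]) /\
  (forall z z' e e', X z -> X z' -> e < size (t (z 0)) -> e' < size (t (z' 0)) ->
     sh e (subst_right t z) = sh e' (subst_right t z') -> z = z' /\ e = e').

(** Offsets are bounded by the longest block, so approximate desubstitutions have a convergent
    subsequence with constant offset. The predicate [Q] carries a property of the approximants
    along, to be confronted with the limit. *)
Lemma tower_limit n (t : subst n) X y
    (Q : nat -> (nat -> 'I_n) -> nat -> Prop) :
  closed_set X ->
  (forall l, exists z e, [/\ X z, e < size (t (z 0)),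
     forall i, i < l -> y i = sh e (subst_right t z) i & Q l z e]) ->
  exists z e, [/\ X z, e < size (t (z 0)), y = sh e (subst_right t z) &
    forall L, exists l z', Q l z' e /\ forall i, i < L -> z' i = z i].
Proof.
move=> clX approx.
have [zs zsP] := functional_choice _ approx.
have [es esP] := functional_choice _ zsP.
pose B := (\max_a size (t a)).+1.
have es_lt l : es l < B.
  have [_ lt_e _ _] := esP l; rewrite ltnS (leq_trans (ltnW lt_e)) //.
  exact: (leq_bigmax (zs l 0)).
(* The offset is attached to every letter, so that one cluster point settles both the sequence and
   the offset. *)
have [ze zeP] := cluster_point (fun l i => (zs l i, Ordinal (es_lt l))).
exists (fun i => (ze i).1), (ze 0).2.
have near L M : exists l, [/\ M <= l, es l = (ze 0).2 &
    forall i, i < L -> zs l i = (ze i).1].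
  have [l [le_l eq_l]] := zeP L.+1 M; exists l; split=> //.
    by rewrite -(eq_l 0).
  by move=> i lt_i; rewrite -(eq_l i) // ltnW.
have [l [_ e0 eq0]] := near 1 0; have [_ lt0 _ _] := esP l.
split=> [||| L].
- apply: clX => L; have [l' [_ _ eq']] := near L 0.
  by exists (zs l'); split=> //; case: (esP l').
- by rewrite -e0 -eq0.
- apply: functional_extensionality => i.
  have [l' [lt_i e' eq']] := near ((ze 0).2 + i).+1 i.+1.
  have [_ _ -> // _] := esP l'; rewrite e' /sh.
  by apply: subst_right_agree => j le_j; apply: eq'.
- have [l' [_ e' eq']] := near L 0; exists l', (zs l'); split=> //.
  by rewrite -e'; case: (esP l').
Qed.

Lemma tower_comp n (t1 t2 t : subst n) X :
  nonerasing t1 -> nonerasing t2 -> (forall a, t a = subst_word t1 (t2 a)) ->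
  (forall k x, X x -> X (sh k x)) -> (forall x, X x -> X (subst_right t2 x)) ->
  tower t1 X -> tower t2 X -> tower t X.
Proof.
move=> t1_gt0 t2_gt0 tE Xsh Xt2 [ex1 uq1] [ex2 uq2].
have srE := subst_right_comp _ t1_gt0 t2_gt0 tE.
have pre2 x k : k <= size (t2 (x 0)) ->
    mkseq (subst_right t2 x) k = take k (t2 (x 0)).
  by move=> le_k; rewrite (subst_right1 t2_gt0) mkseq_scat_take.
split=> [y Xy | z z' e e' Xz Xz' lt_e lt_e'].
  have [z1 [e1 [Xz1 lt_e1 ->]]] := ex1 y Xy.
  have [z [e2 [Xz lt_e2 eq_z1]]] := ex2 z1 Xz1.
  exists z, (size (subst_word t1 (mkseq (subst_right t2 z) e2)) + e1).
  split=> //.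
    rewrite pre2 ?(ltnW lt_e2) // tE.
    rewrite -[in X in _ < X](cat_take_drop e2 (t2 (z 0))) subst_word_cat size_cat.
    rewrite ltn_add2l (drop_nth (z 0)) // -cat1s subst_word_cat subst_word1.
    rewrite size_cat ltn_addr //; move: lt_e1.
    by rewrite eq_z1 /sh addn0 (subst_right1 t2_gt0) (scat_lt (z 0)).
  by rewrite srE -shD sh_subst_right // eq_z1.
(* An offset inside [t1 (t2 a)] is a position [k] in [t2 a] plus an offset in the block of the
   letter found there; uniqueness for [t1] and then for [t2] applies. *)
have split_at x r : X x -> r < size (t (x 0)) -> exists k r1,
    [/\ k < size (t2 (x 0)), r1 < size (t1 (sh k (subst_right t2 x) 0)),
        r = size (subst_word t1 (mkseq (subst_right t2 x) k)) + r1 &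
        sh r (subst_right t x) = sh r1 (subst_right t1 (sh k (subst_right t2 x)))].
  move=> Xx lt_r.
  have [k [r1 [lt_r1 eq_r]]] := locate t1_gt0 (subst_right t2 x) r.
  exists k, r1; split=> //.
  - rewrite ltnNge; apply/negP => le_k; move: lt_r; apply/negP; rewrite -leqNgt.
    rewrite eq_r tE -(subnKC le_k) subst_word_mkseqD size_cat pre2 // take_size.
    by rewrite -addnA leq_addr.
  - by rewrite /sh addn0.
  - by rewrite eq_r srE -shD sh_subst_right.
have [k [r [lt_k lt_r -> ->]]] := split_at z e Xz lt_e.
have [k' [r' [lt_k' lt_r' -> ->]]] := split_at z' e' Xz' lt_e'.
move=> eq_sh.
have [eq_k eq_r] := uq1 _ _ _ _ (Xsh _ _ (Xt2 _ Xz)) (Xsh _ _ (Xt2 _ Xz')) lt_r lt_r' eq_sh.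
by have [-> ->] := uq2 _ _ _ _ Xz Xz' lt_k lt_k' eq_k; rewrite eq_r.
Qed.

Lemma tower_pow n (t : subst n) X j :
  nonerasing t -> (forall k x, X x -> X (sh k x)) ->
  (forall x, X x -> X (subst_right t x)) -> tower t X -> tower (subst_pow t j) X.
Proof.
move=> t_gt0 Xsh Xt tow; elim: j => [|j IH].
  split=> [y Xy | z z' [|//] [|//] _ _ _ _].
    by exists y, 0; split=> //; rewrite subst_right_pow0.
  by rewrite !subst_right_pow0.
apply: (tower_comp t_gt0 (nonerasing_pow j t_gt0)) => // x Xx.
elim: j {IH} => [|j IH]; first by rewrite subst_right_pow0.
by rewrite subst_right_powS //; apply: Xt.
Qed.

(** * The Bratteli-Vershik representation *)

Section BratteliVershik.
Variables (N : nat) (t : subst N) (X : (nat -> 'I_N) -> Prop).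
Hypothesis t_gt1 : forall a, 1 < size (t a).
Hypothesis X_closed : closed_set X.
Hypothesis X_shift : forall x, X x -> X (sh 1 x).
Hypothesis X_subst : forall x, X x -> X (subst_right t x).
Hypothesis X_letter : forall a, exists x, X x /\ x 0 = a.
Hypothesis t_tower : tower t X.
Hypothesis t_next : forall x y, X x -> X y -> x 0 = y 0 ->
  subst_right t (sh 1 x) 0 = subst_right t (sh 1 y) 0.

Let t_gt0 : nonerasing t. Proof. by move=> a; apply: ltnW. Qed.

Let X_sh k x : X x -> X (sh k x).
Proof. by elim: k => // k IH /IH /X_shift; rewrite shD addn1. Qed.

Lemma desubst_exists : exists (D : (nat -> 'I_N) -> nat -> 'I_N) (S : (nat -> 'I_N) -> nat),
  forall y, X y -> [/\ X (D y), S y < size (t (D y 0)) & y = sh (S y) (subst_right t (D y))].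
Proof.
have ex y : exists ze : (nat -> 'I_N) * nat, X y ->
    [/\ X ze.1, ze.2 < size (t (ze.1 0)) & y = sh ze.2 (subst_right t ze.1)].
  case: (classic (X y)) => [Xy | nXy]; last by exists (y, 0).
  by have [z [e ze]] := t_tower.1 y Xy; exists (z, e).
have [f fP] := functional_choice _ ex.
by exists (fun y => (f y).1), (fun y => (f y).2).
Qed.

Variables (D : (nat -> 'I_N) -> nat -> 'I_N) (S : (nat -> 'I_N) -> nat).
Hypothesis DS : forall y, X y ->
  [/\ X (D y), S y < size (t (D y 0)) & y = sh (S y) (subst_right t (D y))].

Lemma desubst_uniq z e : X z -> e < size (t (z 0)) ->
  D (sh e (subst_right t z)) = z /\ S (sh e (subst_right t z)) = e.
Proof.
move=> Xz lt_e; have Xy : X (sh e (subst_right t z)) by exact: X_sh (X_subst Xz).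
have [XD ltS eq_y] := DS Xy.
by have [<- <-] := t_tower.2 _ _ _ _ Xz XD lt_e ltS eq_y.
Qed.

(** Otherwise points ever closer to [x] have desubstitutions that differ from that of [x] in the
    offset or before [L]; [tower_limit] turns them into a second desubstitution of [x], against
    uniqueness. *)
Lemma desubst_cont x L : X x -> exists l, forall y, X y ->
  (forall i, i < l -> y i = x i) -> S y = S x /\ forall i, i < L -> D y i = D x i.
Proof.
move=> Xx; apply: NNPP => no_l.
have bad l : exists z e, [/\ X z, e < size (t (z 0)),
    forall i, i < l -> x i = sh e (subst_right t z) i &
    ~ (e = S x /\ forall i, i < L -> z i = D x i)].
  apply: NNPP => no_y; apply: no_l; exists l => y Xy eq_y.
  have [XD ltS yE] := DS Xy; apply: NNPP => neq; apply: no_y.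
  by exists (D y), (S y); split=> // i lt_i; rewrite -yE eq_y.
have [z [e [Xz lt_e xE]]] := tower_limit X_closed bad.
move=> /(_ L) [_ [z' [neq eq_z]]]; apply: neq.
by have := desubst_uniq Xz lt_e; rewrite -xE => -[-> ->].
Qed.

(** The edge of index [i.+1] places the first letter of the [i]-fold desubstitution of [x] inside
    the block of the first letter of the next one. *)
Definition path_of x (j : nat) : edge N :=
  if j is i.+1 then (iter j D x 0, S (iter i D x)) else (x 0, 0).

Lemma X_iter j x : X x -> X (iter j D x).
Proof. by move=> Xx; elim: j => // j /DS []. Qed.

Lemma desubst_head x : X x -> x 0 = nth (x 0) (t (D x 0)) (S x).
Proof.
move=> Xx; have [XD ltS eq_x] := DS Xx.
by rewrite {1}eq_x /sh addn0 (subst_right1 t_gt0) (scat_lt (x 0)).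
Qed.

Lemma path_of_bpath x : X x -> bpath t (path_of x).
Proof.
move=> Xx; split=> // j.
have Xj := X_iter j Xx; have [_ ltS _] := DS Xj.
split=> //=; have := desubst_head Xj.
by case: j Xj ltS => [|j] Xj ltS /= <-.
Qed.

Lemma path_ofS x j : path_of x j.+2 = path_of (D x) j.+1.
Proof. by rewrite /path_of -!iterSr. Qed.

Lemma path_of_cont : cont_on X path_of.
Proof.
have iter_cont j : cont_on X (iter j D).
  elim: j => [x _ l|j IH]; first by exists l.
  apply: (cont_comp (Y := X) IH (fun x => @X_iter j x)) => x Xx L.
  by have [l lP] := desubst_cont L Xx; exists l => y Xy /(lP y Xy) [].
have at_ i x : X x -> exists l, forall y, X y ->
    (forall j, j < l -> y j = x j) -> path_of y i = path_of x i.
  move=> Xx; case: i => [|i].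
    by exists 1 => y _ eq_y; rewrite /= eq_y.
  have [l1 l1P] := desubst_cont 1 (X_iter i Xx).
  have [l lP] := iter_cont i x Xx l1.
  exists l => y Xy /(lP y Xy) /(l1P _ (X_iter i Xy)) [eqS eqD].
  by rewrite /= eqS eqD.
move=> x Xx; elim=> [|l [l1 l1P]]; first by exists 0.
have [l2 l2P] := at_ l x Xx; exists (maxn l1 l2) => y Xy eq_y i.
rewrite ltnS leq_eqVlt => /orP [/eqP -> | lt_i].
  by apply: l2P => // j lt_j; apply: eq_y; rewrite leq_max lt_j orbT.
by apply: l1P => // j lt_j; apply: eq_y; rewrite leq_max lt_j.
Qed.

(* A point is read off its path letter by letter; beyond the last letter of a
   block, [t_next] supplies the first letter of the next block. *)
Lemma path_of_inj x y : X x -> X y -> path_of x = path_of y -> x = y.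
Proof.
move=> Xx Xy eq_p; apply: functional_extensionality => i.
elim/ltn_ind: i x y Xx Xy eq_p => i IH x y Xx Xy eq_p.
have eq0 : x 0 = y 0 by have := congr1 fst (congr1 (fun p => p 0) eq_p).
have [XDx ltSx eq_x] := DS Xx; have [XDy ltSy eq_y] := DS Xy.
have := congr1 (fun p => p 1) eq_p; rewrite /= => -[eqD0 eqS].
have eq_pD : path_of (D x) = path_of (D y).
  apply: functional_extensionality => -[|j]; first by rewrite /= eqD0.
  by rewrite -!path_ofS eq_p.
have via k : S x + i < size (subst_word t (mkseq (D x) k)) ->
    (forall j, j < k -> D x j = D y j) -> x i = y i.
  move=> lt_k eq_k; rewrite eq_x eq_y /sh -eqS (nth_subst_right t_gt0 (x 0) lt_k).
  have eq_m : mkseq (D x) k = mkseq (D y) k by apply/eq_mkseqP.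
  by rewrite (nth_subst_right t_gt0 (x 0) (k := k)) -eq_m.
case: i IH via => [//|[|i]] IH via.
  case: (ltnP (S x + 1) (size (t (D x 0)))) => [lt_S | ge_S].
    by apply: (via 1) => [|[]//]; rewrite /mkseq /= subst_word1.
  have next z : X z -> S z < size (t (D z 0)) -> z = sh (S z) (subst_right t (D z)) ->
      size (t (D z 0)) <= S z + 1 -> z 1 = subst_right t (sh 1 (D z)) 0.
    move=> Xz ltSz eq_z ge_Sz; rewrite {1}eq_z /sh (subst_right1 t_gt0).
    by rewrite scat_ge // (_ : _ - _ = 0) //; lia.
  rewrite (next x) // (next y) // ?(t_next XDx XDy eqD0) //.
  by rewrite -eqD0 -eqS.
apply: (via i.+2 _) => [|j lt_j]; last first.
  by apply: IH.
rewrite -[i.+2]add1n subst_word_mkseqD size_cat /mkseq /= subst_word1.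
have := @size_subst_word _ t 2 (mkseq (sh 1 (D x)) i.+1) t_gt1.
by rewrite size_mkseq /mkseq /=; lia.
Qed.

Lemma path_of_approx j w : bpath t w ->
  exists y, X y /\ forall i, i <= j -> path_of y i = w i.
Proof.
elim: j w => [|j IH] w [w0 wP].
  have [y [Xy y0]] := X_letter (w 0).1; exists y; split=> // -[] // _.
  by rewrite /= y0; case: (w 0) w0 => ? ? /= ->.
pose w' i := if i is 0 then ((w 1).1, 0) else w i.+1.
have w'P : bpath t w' by split=> // -[|i]; [exact: (wP 1) | exact: (wP i.+2)].
have [y' [Xy' y'P]] := IH w' w'P.
have y'0 : y' 0 = (w 1).1 by have := congr1 fst (y'P 0 isT).
have [lt_w1 nth_w1] := wP 0; rewrite -y'0 in lt_w1 nth_w1.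
have [Dy Sy] := desubst_uniq Xy' lt_w1.
set y := sh (w 1).2 _ in Dy Sy.
have Xy : X y by exact: X_sh (X_subst Xy').
exists y; split=> // -[|[|i]] le_i.
- rewrite /= (_ : y 0 = (w 0).1); first by case: (w 0) w0 => ? ? /= ->.
  by rewrite (set_nth_default (y 0)) // -Dy in nth_w1; rewrite -nth_w1 -Sy; apply: desubst_head.
- by rewrite /= Dy Sy y'0; case: (w 1).
- by rewrite path_ofS Dy y'P.
Qed.

Lemma path_of_surj w : bpath t w -> exists x, X x /\ path_of x = w.
Proof.
move=> wP; have [ys ysP] := functional_choice _ (fun j => path_of_approx j wP).
have [x xP] := cluster_point ys.
have Xx : X x.
  by apply: X_closed => L; have [l [_ eq_l]] := xP L 0; exists (ys l); case: (ysP l).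
exists x; split=> //; apply: functional_extensionality => i.
have [l' l'P] := path_of_cont Xx i.+1.
have [l [le_l eq_l]] := xP l' i.
by have [Xl pl] := ysP l; rewrite -(l'P _ Xl eq_l) // pl.
Qed.

Lemma desubst_shift_max x : X x -> (S x).+1 = size (t (D x 0)) ->
  D (sh 1 x) = sh 1 (D x) /\ S (sh 1 x) = 0.
Proof.
move=> Xx maxS; have [XD _ eq_x] := DS Xx.
have -> : sh 1 x = sh 0 (subst_right t (sh 1 (D x))).
  rewrite sh0 -(sh_subst_right t_gt0) {1}eq_x shD addn1 maxS.
  by rewrite /mkseq /= subst_word1.
by apply: desubst_uniq; [exact: X_shift | exact: t_gt0].
Qed.

(** The shift acts as an odometer: each maximal edge is reset with a carry to the next level, and at
    the first non-maximal edge the offset grows by one inside the same block, which leaves all later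
    desubstitutions alone. *)
Lemma vershik_path_of x : X x -> nonmaximal t (path_of x) ->
  vershik_rel t (path_of x) (path_of (sh 1 x)).
Proof.
move=> Xx nmax.
pose nm j := (0 < j) && ((path_of x j).2.+1 < size (t (path_of x j).1)).
have nmP j : reflect (nonmax_at t (path_of x) j) (nm j) by exact: andP.
have [k0 /nmP nm_k0] := nmax.
case: (ex_minnP (ex_intro nm k0 nm_k0)) => -[|k] /nmP nm_k k_min; first by case: nm_k.
have iter_sh j : j <= k -> iter j D (sh 1 x) = sh 1 (iter j D x) /\
    forall i, i < j -> S (iter i D (sh 1 x)) = 0.
  elim: j => [//|j IH] lt_j; have [eqj Sj] := IH (ltnW lt_j).
  have Xj := X_iter j Xx; have [_ ltS _] := DS Xj.
  have maxS : (S (iter j D x)).+1 = size (t (D (iter j D x) 0)).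
    apply/eqP; rewrite eqn_leq ltS leqNgt; apply/negP => lt_S.
    by have := k_min j.+1; rewrite /nm /= lt_S ltnNge lt_j => /(_ isT).
  have [eqD eqS] := desubst_shift_max Xj maxS.
  split=> [|i]; first by rewrite /= eqj.
  by rewrite ltnS leq_eqVlt => /orP [/eqP -> | /Sj //]; rewrite eqj.
have [eqk Sk] := iter_sh k (leqnn k).
have Xk := X_iter k Xx; have [XD _ eq_xk] := DS Xk.
have [_ lt_S] := nm_k.
have [Dk1 Sk1] : D (iter k D (sh 1 x)) = D (iter k D x) /\
    S (iter k D (sh 1 x)) = (S (iter k D x)).+1.
  by rewrite eqk {1 3}eq_xk shD addn1; apply: desubst_uniq.
have eq_iter j : k < j -> iter j D (sh 1 x) = iter j D x.
  by move=> lt_j; rewrite -(subnK lt_j) !iterD /= Dk1.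
exists k.+1; split=> //; split=> [j lt_j /nmP nm_j|].
  by have := k_min j nm_j; rewrite leqNgt lt_j.
split; first by rewrite /= Dk1 Sk1.
split=> [[//|j] lt_j|]; first by rewrite /path_of !eq_iter // ltnW.
split=> [[//|j] lt_j|]; first by rewrite /= Sk.
exact/path_of_bpath/X_shift.
Qed.

End BratteliVershik.

Lemma bratteli_vershik_conj N (t : subst N) (X : (nat -> 'I_N) -> Prop) :
  (forall a, 1 < size (t a)) -> closed_set X ->
  (forall x, X x -> X (sh 1 x)) -> (forall x, X x -> X (subst_right t x)) ->
  (forall a, exists x, X x /\ x 0 = a) -> tower t X ->
  (forall x y, X x -> X y -> x 0 = y 0 ->
    subst_right t (sh 1 x) 0 = subst_right t (sh 1 y) 0) ->
  exists F : (nat -> edge N) -> (nat -> edge N),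
    (forall x, bpath t x -> bpath t (F x)) /\
    (forall x, bpath t x -> nonmaximal t x -> vershik_rel t x (F x)) /\
    cont_on (bpath t) F /\ topo_conj X shift (bpath t) F.
Proof.
move=> t_gt1 clX X_shift X_subst X_letter tow t_next.
have [D [S DS]] := desubst_exists tow.
pose phi := path_of D S.
have phiP x : X x -> bpath t (phi x) by apply: path_of_bpath.
have phi_cont : cont_on X phi by exact: (path_of_cont clX X_shift X_subst tow DS).
have phi_inj x y : X x -> X y -> phi x = phi y -> x = y.
  exact: (path_of_inj t_gt1 t_next DS).
have ex w : exists x, bpath t w -> X x /\ phi x = w.
  case: (classic (bpath t w)) => [wP|]; last by exists (fun i => (w i).1).
  by have [x xP] := path_of_surj t_gt1 clX X_shift X_subst X_letter tow DS wP; exists x.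
have [psi psiP] := functional_choice _ ex.
have psi_cont : cont_on (bpath t) psi.
  move=> w wP L; have [Xw eq_w] := psiP w wP.
  have [l lP] := inverse_cont clX phi_cont phi_inj Xw L.
  by exists l => v /psiP [Xv eq_v] eq_vw; apply: lP; rewrite // eq_v eq_w.
(* Conjugating the shift by the path coding gives a map defined at maximal paths too; by
   [vershik_path_of] it agrees with the Vershik map at the other paths, so it is the required
   extension. *)
exists (fun w => phi (shift (psi w))); split; last split; last split.
- by move=> w /psiP [Xw _]; apply: phiP; apply: X_shift.
- move=> w /psiP [Xw eq_w]; rewrite -{1 2}eq_w.
  exact: (vershik_path_of t_gt1 X_shift X_subst tow DS).
- apply: (cont_comp (Y := X) _ _ phi_cont) => [|w /psiP [/X_shift //]].
  by apply: (cont_comp psi_cont (Y := X)); [move=> w /psiP [] | exact: cont_shift].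
exists phi, psi; split=> //; split=> [w /psiP [] //|].
split=> [x Xx|]; first by have [Xpx] := psiP _ (phiP x Xx); apply: phi_inj.
split=> [w /psiP [] //|]; split=> //; split=> // x Xx.
by have [Xpx /(phi_inj _ _ Xpx Xx) ->] := psiP _ (phiP x Xx).
Qed.

(** * Primitive substitutions *)

Lemma infinite_alphabet n (X : (nat -> 'I_n) -> Prop) : infinite_set X -> 1 < n.
Proof.
move=> infX; rewrite ltnNge; apply/negP => n_le1; apply: infX.
case: n X n_le1 => [|[|//]] X _; first by exists nil => x _; case: (x 0).
exists (cons (fun=> ord0) nil) => x _; left.
by apply: functional_extensionality => i; rewrite (ord1 (x i)).
Qed.

Section PrimitiveSubstitution.
Variables (n : nat) (t : subst n).
Hypothesis t_gt0 : nonerasing t.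
Hypothesis t_primitive : primitive t.
Hypothesis n_gt1 : 1 < n.

Let X := Xsub t.

Lemma subst_pow_positive : exists K, forall j, K <= j -> forall a b, b \in subst_pow t j a.
Proof.
have [K [_ posK]] := t_primitive; exists K => j /subnKC <- a b.
rewrite subst_powD.
case: (subst_pow t (j - K) a) (nonerasing_pow (j - K) t_gt0 a) => // c w _.
by rewrite -cat1s subst_word_cat subst_word1 mem_cat posK.
Qed.

Lemma subst_pow_size2 : exists K, forall j, K <= j -> forall a, 1 < size (subst_pow t j a).
Proof.
have [K posK] := subst_pow_positive; exists K => j le_j a.
have := @uniq_leq_size _ (enum 'I_n) (subst_pow t j a) (enum_uniq _).
rewrite size_enum_ord => le_s; apply: leq_trans n_gt1 (le_s _).
by move=> b _; apply: posK.
Qed.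

Lemma subst_pow_growth l : exists j, forall a, l <= size (subst_pow t j a).
Proof.
have [K K2] := subst_pow_size2; elim: l => [|l [j jP]]; first by exists 0.
exists (K + j) => a; rewrite subst_powD.
have := size_subst_word (subst_pow t j a) (K2 K (leqnn K)).
have := jP a; have := nonerasing_pow j t_gt0 a; lia.
Qed.

Lemma lang_recurrent w : lang t w -> exists j, forall a, infix w (subst_pow t j a).
Proof.
move=> [j [b wb]]; have [K posK] := subst_pow_positive.
exists (j + K) => a; rewrite subst_powD; apply: infix_trans wb _.
have /infix_subst_word : infix [:: b] (subst_pow t K a) by rewrite infix1s posK.
by move=> /(_ (subst_pow t j)); rewrite subst_word1.
Qed.

Lemma lang_right_fixed v l : right_fixed t v -> lang t (mkseq v l).
Proof.
move=> v_fixed; have [j jP] := subst_pow_growth l; exists j, (v 0).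
rewrite -{1}(right_fixed_pow j t_gt0 v_fixed).
rewrite (subst_right1 (nonerasing_pow j t_gt0)) mkseq_scat_take //.
rewrite -[X in infix _ X](cat_take_drop l); exact: prefix_infix.
Qed.

Section FixedPoint.
Variable u : nat -> 'I_n.
Hypothesis u_fixed : right_fixed t u.

Lemma right_fixed_powE j k : u = scat (subst_word (subst_pow t j) (mkseq u k))
  (subst_right (subst_pow t j) (sh k u)).
Proof.
rewrite -(subst_rightE (nonerasing_pow j t_gt0)).
by rewrite (right_fixed_pow j t_gt0 u_fixed).
Qed.

Lemma lang_occurs w : lang t w -> exists k, 0 < k /\ mkseq (sh k u) (size w) = w.
Proof.
(* The word is sought in an image of [u 1], past the nonempty image of [u 0]; the position is thus
   positive and the occurrence has a left neighbour. *)
case/lang_recurrent => j /(_ (u 1)) /infixP [s1 [s2 eq_u1]].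
have j_gt0 := nonerasing_pow j t_gt0 (u 0).
exists (size (subst_pow t j (u 0) ++ s1)); split.
  by rewrite size_cat ltn_addr.
have eq2 : subst_word (subst_pow t j) (mkseq u 2) =
    (subst_pow t j (u 0) ++ s1) ++ w ++ s2.
  have -> : mkseq u 2 = [:: u 0] ++ [:: u 1] by [].
  by rewrite subst_word_cat !subst_word1 eq_u1 -!catA.
rewrite {2}(right_fixed_powE j 2) eq2 scat_cat sh_scat_size.
by rewrite scat_cat mkseq_scat.
Qed.

(** Fixed points have all their words in the language, and primitivity makes every word of the
    language occur in [u]. So [X] depends on the language only, not on the fixed point chosen. *)
Lemma Xsub_langP x : X x <-> forall l, lang t (mkseq x l).
Proof.
split=> [[v [v_fixed vx]] l | x_lang].
  have [k eq_k] := vx l.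
  have -> : mkseq x l = mkseq (sh k v) l by apply/eq_mkseqP.
  exact/lang_mkseq_sh/lang_right_fixed.
exists u; split=> // l; have [k [_ eq_k]] := lang_occurs (x_lang l).
by exists k => i lt_i; rewrite size_mkseq in eq_k; apply/esym/((eq_mkseqP _ _ _).1 eq_k).
Qed.

Lemma Xsub_occurs x l : X x -> exists k, 0 < k /\ forall i, i < l -> sh k u i = x i.
Proof.
move=> /Xsub_langP /(_ l) /lang_occurs [k [k_gt0]].
by rewrite size_mkseq => /eq_mkseqP eq_k; exists k.
Qed.

Lemma Xsub_closed : closed_set X.
Proof.
move=> x xP; apply/Xsub_langP => l; have [y [/Xsub_langP Xy eq_y]] := xP l.
by have <- : mkseq y l = mkseq x l by apply/eq_mkseqP.
Qed.

Lemma Xsub_sh k x : X x -> X (sh k x).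
Proof. by move=> /Xsub_langP xP; apply/Xsub_langP => l; apply: lang_mkseq_sh. Qed.

Lemma Xsub_subst x : X x -> X (subst_right t x).
Proof.
move=> /Xsub_langP xP; apply/Xsub_langP => l.
have := leq_size_subst_word t_gt0 (mkseq x l); rewrite size_mkseq => le_l.
apply: (lang_mkseq_leq le_l); rewrite mkseq_subst_right //.
exact: lang_subst_word.
Qed.

Lemma Xsub_subst_pow j x : X x -> X (subst_right (subst_pow t j) x).
Proof.
move=> Xx; elim: j => [|j IH]; first by rewrite subst_right_pow0.
by rewrite subst_right_powS //; apply: Xsub_subst.
Qed.

Lemma Xsub_fixed : X u. Proof. by apply/Xsub_langP => l; apply: lang_right_fixed. Qed.

Lemma Xsub_shift_surj x : X x -> exists y, X y /\ sh 1 y = x.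
Proof.
move=> Xx.
have ex l : exists y, X y /\ forall i, i < l -> y i.+1 = x i.
  have [k [k_gt0 eq_k]] := Xsub_occurs l Xx.
  exists (sh k.-1 u); split; first exact: Xsub_sh Xsub_fixed.
  by move=> i /eq_k <-; rewrite /sh -addSnnS prednK.
have [ys ysP] := functional_choice _ ex; have [y yP] := cluster_point ys.
exists y; split.
  apply: Xsub_closed => L; have [l [_ eq_l]] := yP L 0.
  by exists (ys l); case: (ysP l).
apply: functional_extensionality => i; have [l [lt_l eq_l]] := yP i.+2 i.+1.
by rewrite /sh add1n -eq_l //; apply: (ysP l).2.
Qed.

Lemma Xsub_word2 a b : lang t [:: a; b] -> exists x, [/\ X x, x 0 = a & x 1 = b].
Proof.
move=> /lang_occurs [k [_ eq_k]]; exists (sh k u).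
by split; [exact: Xsub_sh Xsub_fixed | |]; case: eq_k; rewrite /sh.
Qed.

Lemma desubst_Xsub y : X y ->
  exists z e, [/\ X z, e < size (t (z 0)) & y = sh e (subst_right t z)].
Proof.
move=> Xy.
have approx l : exists z e, [/\ X z, e < size (t (z 0)),
    forall i, i < l -> y i = sh e (subst_right t z) i & True].
  have [k [_ eq_k]] := Xsub_occurs l Xy.
  have [q [e [lt_e eq_kq]]] := locate t_gt0 u k.
  exists (sh q u), e; split=> //; first exact: Xsub_sh Xsub_fixed.
    by rewrite /sh addn0.
  by move=> i lt_i; rewrite -sh_subst_right // shD -eq_kq u_fixed eq_k.
have [z [e [Xz lt_e eq_y _]]] := tower_limit Xsub_closed approx.
by exists z, e.
Qed.

Lemma periodic_Xsub_finite d : 0 < d -> sh d u = u -> ~ infinite_set X.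
Proof.
move=> d_gt0 per_u; apply.
have per k : sh (k * d) u = u.
  by elim: k => // k IH; rewrite mulSnr -shD IH.
exists (List.map (fun k => sh k u) (List.seq 0 d)) => x Xx.
have [f fP] := functional_choice _ (fun l => Xsub_occurs l Xx).
have lt_f l : f l %% d < d by rewrite ltn_mod.
(* A cluster point of constant sequences serves as a pigeonhole: one residue of [f l] modulo [d]
   recurs for arbitrarily large [l]. *)
have [z zP] := cluster_point (fun l (_ : nat) => Ordinal (lt_f l)).
apply/List.in_map_iff; exists (z 0); split; last first.
  by apply/List.in_seq; split; apply/leP => //=; rewrite add0n.
apply: functional_extensionality => i; have [l [lt_l eq_l]] := zP 1 i.+1.
rewrite -(fP l).2 // -(eq_l 0) //= {2}(divn_eq (f l) d) -shD per.
by [].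
Qed.

End FixedPoint.

(** Applying [t^K] gives [u = t^K(w) v] besides [u = w v]. If [w] is nonempty its image is longer,
    so [v] has the difference of the two lengths as a period, and [X] is finite. *)
Lemma fixed_points_not_tail v u w : infinite_set X -> right_fixed t v -> right_fixed t u ->
  u = scat w v -> size w = 0.
Proof.
move=> infX v_fixed u_fixed eq_u; have [K K2] := subst_pow_size2.
apply/eqP; rewrite -leqn0 leqNgt; apply/negP => w_gt0.
have eq_u' : u = scat (subst_word (subst_pow t K) w) v.
  rewrite -(right_fixed_pow K t_gt0 u_fixed) {1}eq_u subst_right_scat //.
    by rewrite (right_fixed_pow K t_gt0 v_fixed).
  exact: nonerasing_pow.
have lt_w : size w < size (subst_word (subst_pow t K) w).
  by have := size_subst_word w (K2 K (leqnn K)); lia.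
have sh1 : sh (size w) u = v by rewrite eq_u sh_scat_size.
pose d := size (subst_word (subst_pow t K) w) - size w.
apply: (@periodic_Xsub_finite _ v_fixed d _ _ infX); first by rewrite subn_gt0.
by rewrite -{1}sh1 shD subnKC ?(ltnW lt_w) // {1}eq_u' sh_scat_size.
Qed.

End PrimitiveSubstitution.

(** * Recognizability *)

Section Recognizability.
Variables (n : nat) (t : subst n) (u : nat -> 'I_n).
Hypothesis t_gt0 : nonerasing t.
Hypothesis t_primitive : primitive t.
Hypothesis X_infinite : infinite_set (Xsub t).
Hypothesis u_fixed : right_fixed t u.
Hypothesis t_recognizable : unilat_recognizable t.
Hypothesis t_inj : injective t.
Hypothesis branch_fixed : forall x, branch_point (Xsub t) x -> right_fixed t x.

Let X := Xsub t.
Let n_gt1 := infinite_alphabet X_infinite.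
Let X_sh k x : X x -> X (sh k x). Proof. exact: Xsub_sh u_fixed k x. Qed.
Let X_subst x : X x -> X (subst_right t x). Proof. exact: Xsub_subst u_fixed x. Qed.

(** Recognizability speaks of positions in [u] only. Long prefixes of [z] and [z'] are therefore
    located in [u]; the cut is transferred there and read back in [z']. *)
Lemma cut_transfer z z' e e' k : X z -> X z' ->
  sh e (subst_right t z) = sh e' (subst_right t z') ->
  size (subst_word t (mkseq z k)) = e ->
  exists k', size (subst_word t (mkseq z' k')) = e'.
Proof.
move=> Xz Xz' eq_sh eq_e.
have [L LP] := t_recognizable u_fixed.
(* A prefix of length [r + L + k] fixes the first [r + L] letters of the image, blocks being
   nonempty, and also the first [k] blocks. *)
have window y r : X y -> exists q, [/\ 0 < q,
    forall i, i < r + L + k -> sh q u i = y i &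
    mkseq (sh (size (subst_word t (mkseq u q)) + r) u) L =
    mkseq (sh r (subst_right t y)) L].
  move=> Xy; have [q [q_gt0 eq_q]] :=
    Xsub_occurs t_gt0 t_primitive n_gt1 u_fixed (r + L + k) Xy.
  exists q; split=> //; apply/eq_mkseqP => i lt_i.
  rewrite (_ : sh (_ + r) u = sh r (subst_right t (sh q u))); last first.
    by rewrite -shD -sh_subst_right // u_fixed.
  rewrite /sh.
  by apply: subst_right_agree => j le_j; apply: eq_q; lia.
have [q [q_gt0 eq_q win]] := window z e Xz.
have [q' [q'_gt0 eq_q' win']] := window z' e' Xz'.
case: (LP (size (subst_word t (mkseq u q)) + e) (size (subst_word t (mkseq u q')) + e')).
- by rewrite -[LHS]/(mkseq (sh _ u) L) win eq_sh -win'.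
- right; exists (q + k); split; first by rewrite ltn_addr.
  rewrite subst_word_mkseqD size_cat; congr addn.
  rewrite -eq_e; congr (size (subst_word t _)).
  by apply/eq_mkseqP => i lt_i; rewrite eq_q // ltn_addl.
(* Position 0 is a cut by convention; it is excluded because [q'] is positive. *)
- move/eqP; rewrite addn_eq0 => /andP [/eqP sz0 _].
  have := leq_size_subst_word t_gt0 (mkseq u q'); rewrite sz0 size_mkseq; lia.
move=> [p [_ eq_p]].
have /(subst_word_prefix_mono t_gt0) le_qp : size (subst_word t (mkseq u q')) <=
    size (subst_word t (mkseq u p)) by rewrite -eq_p leq_addr.
exists (p - q'); move: eq_p; rewrite -{1}(subnKC le_qp) subst_word_mkseqD size_cat.
move/addnI => eq_e'.
have := leq_size_subst_word t_gt0 (mkseq (sh q' u) (p - q')).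
rewrite -eq_e' size_mkseq => le_p.
rewrite eq_e'; congr (size (subst_word t _)).
by apply/eq_mkseqP => i lt_i; rewrite eq_q' //; lia.
Qed.

(** The end of the block of [z 0] is a cut for [z], hence for [z'], and it lies beyond [e']; so it
    does not come before the end of the block of [z' 0]. *)
Lemma cut_next_le z z' e e' : X z -> X z' ->
  e < size (t (z 0)) -> e' < size (t (z' 0)) ->
  sh e (subst_right t z) = sh e' (subst_right t z') ->
  e + size (t (z' 0)) <= e' + size (t (z 0)).
Proof.
move=> Xz Xz' lt_e lt_e' eq_sh.
pose g := size (t (z 0)) - e.
have eq_shg : sh (e + g) (subst_right t z) = sh (e' + g) (subst_right t z').
  by rewrite -!shD eq_sh.
have e_g : size (subst_word t (mkseq z 1)) = e + g.
  by rewrite /mkseq /= subst_word1 /g; lia.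
have [[|k'] eq_k'] := cut_transfer Xz Xz' eq_shg e_g.
  by move: eq_k'; rewrite /mkseq /= /subst_word /= /g; lia.
move: eq_k'; rewrite -[k'.+1]add1n subst_word_mkseqD size_cat /mkseq /= subst_word1.
rewrite /g; lia.
Qed.

Lemma cut_next z z' e e' : X z -> X z' ->
  e < size (t (z 0)) -> e' < size (t (z' 0)) ->
  sh e (subst_right t z) = sh e' (subst_right t z') ->
  e + size (t (z' 0)) = e' + size (t (z 0)).
Proof.
move=> Xz Xz' lt_e lt_e' eq_sh; apply/eqP; rewrite eqn_leq !cut_next_le //.
Qed.

Lemma subst_right_inj z z' : X z -> X z' ->
  subst_right t z = subst_right t z' -> z = z'.
Proof.
move=> Xz Xz' eq_t; apply: functional_extensionality => i.
elim: i z z' Xz Xz' eq_t => [|i IH] z z' Xz Xz' eq_t;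
  have eq_sz := @cut_next z z' 0 0 Xz Xz' (t_gt0 _) (t_gt0 _) eq_t;
  move: eq_t; rewrite (subst_right1 t_gt0 z) (subst_right1 t_gt0 z') => /scat_inj [] //; [by move=> /t_inj|].
by move=> _ eq_t; apply: (IH (sh 1 z) (sh 1 z')) => //; apply: X_sh.
Qed.

(* Two desubstitutions of one point have equal tails; if they differ, that tail
   is a branch point, hence fixed, and the common suffix of the two blocks
   prepended to it is again a branch point, hence fixed: impossible. *)
Lemma desubst_Xsub_uniq z z' e e' : X z -> X z' ->
  e < size (t (z 0)) -> e' < size (t (z' 0)) ->
  sh e (subst_right t z) = sh e' (subst_right t z') -> z = z' /\ e = e'.
Proof.
elim: e e' z z' => [|e IH] [|e'] z z' Xz Xz' lt_e lt_e' eq_sh.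
- by split=> //; apply: subst_right_inj.
(* Offset 0 is a cut for [z], so [e'.+1] would be a cut for [z'] strictly inside the block of
   [z' 0]. *)
- have [k' eq_k'] := @cut_transfer _ _ _ _ 0 Xz Xz' eq_sh erefl.
  case: k' eq_k' => [//|k']; rewrite -[k'.+1]add1n subst_word_mkseqD size_cat.
  by rewrite {1}/mkseq /= subst_word1; lia.
- have [k' eq_k'] := @cut_transfer _ _ _ _ 0 Xz' Xz (esym eq_sh) erefl.
  case: k' eq_k' => [//|k']; rewrite -[k'.+1]add1n subst_word_mkseqD size_cat.
  by rewrite {1}/mkseq /= subst_word1; lia.
have eq_sz := cut_next Xz Xz' lt_e lt_e' eq_sh.
have drop_e y r : r <= size (t (y 0)) ->
    sh r (subst_right t y) = scat (drop r (t (y 0))) (subst_right t (sh 1 y)).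
  by move=> le_r; rewrite (subst_right1 t_gt0) sh_scat.
have [eq_w eq_tail] : drop e.+1 (t (z 0)) = drop e'.+1 (t (z' 0)) /\
    subst_right t (sh 1 z) = subst_right t (sh 1 z').
  apply: scat_inj; first by rewrite !size_drop; lia.
  by rewrite -!drop_e // ltnW.
have eq_z1 := subst_right_inj (X_sh 1 Xz) (X_sh 1 Xz') eq_tail.
pose v := sh e (subst_right t z); pose v' := sh e' (subst_right t z').
have v1 : sh 1 v = sh e.+1 (subst_right t z) by rewrite shD addn1.
have v1' : sh 1 v' = sh e.+1 (subst_right t z) by rewrite shD addn1 eq_sh.
have Xv : X v by exact: (X_sh e (X_subst Xz)).
have Xv' : X v' by exact: (X_sh e' (X_subst Xz')).
case: (classic (v = v')) => [eq_v | neq_v].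
  by have [-> ->] := IH e' z z' Xz Xz' (ltnW lt_e) (ltnW lt_e') eq_v.
have neq_z : z <> z'.
  move=> eq_z; apply: neq_v; rewrite eq_z in eq_sz.
  by rewrite /v /v' eq_z (_ : e = e') //; lia.
have tail_fixed : right_fixed t (sh 1 z).
  by apply: branch_fixed; split; [exact: X_sh | exists z, z'].
have point_fixed : right_fixed t (sh e.+1 (subst_right t z)).
  by apply: branch_fixed; split; [exact: (X_sh e.+1 (X_subst Xz)) | exists v, v'].
have eq_point : sh e.+1 (subst_right t z) = scat (drop e.+1 (t (z 0))) (sh 1 z).
  by rewrite drop_e ?(ltnW lt_e) // tail_fixed.
have := fixed_points_not_tail t_gt0 t_primitive n_gt1 X_infinite tail_fixed point_fixed eq_point.
by rewrite size_drop; lia.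
Qed.

Lemma tower_Xsub : tower t X.
Proof. by split; [exact: (desubst_Xsub t_gt0 t_primitive n_gt1 u_fixed) | exact: desubst_Xsub_uniq]. Qed.

End Recognizability.

(** * Fixed points of expanding substitutions *)

Section ExpandingFixedPoints.
Variables (n : nat) (t : subst n).
Hypothesis t_gt1 : forall a, 1 < size (t a).

Let t_gt0 : nonerasing t. Proof. by move=> a; apply: ltnW. Qed.

(** Blocks have length at least 2, so letter [i.+1] of a fixed point already lies in the image of
    its first [i.+1] letters: the first letter determines the rest. *)
Lemma right_fixed_uniq x y : right_fixed t x -> right_fixed t y -> x 0 = y 0 -> x = y.
Proof.
move=> fx fy eq0; apply: functional_extensionality => i.
elim/ltn_ind: i => -[//|i] IH.
have szP z : i.+1 < size (subst_word t (mkseq z i.+1)).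
  have := size_subst_word (mkseq z i.+1) t_gt1; rewrite size_mkseq; lia.
rewrite -fx -fy (nth_subst_right t_gt0 (x 0) (szP x)) (nth_subst_right t_gt0 (x 0) (szP y)).
by rewrite (_ : mkseq x i.+1 = mkseq y i.+1) //; apply/eq_mkseqP.
Qed.

Lemma right_fixed_exists a : nth a (t a) 0 = a -> exists x, right_fixed t x /\ x 0 = a.
Proof.
move=> t_a; pose w k := subst_pow t k a.
have w_ext k : exists v, w k.+1 = w k ++ v.
  elim: k => [|k [v eq_v]].
    rewrite /w subst_powS /= subst_word1; exists (behead (t a)).
    by move: t_a (t_gt0 a); case: (t a) => //= b v ->.
  by exists (subst_word t v); rewrite -[w k.+2]/(subst_word t (w k.+1)) {1}eq_v subst_word_cat.
have w_ext_le k l : k <= l -> exists v, w l = w k ++ v.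
  move/subnK <-; elim: (l - k) => [|d [v eq_v]]; first by exists [::]; rewrite cats0.
  by have [v' eq_v'] := w_ext (d + k); exists (v ++ v'); rewrite addSn eq_v' eq_v catA.
have w_size k : k < size (w k).
  elim: k => // k IH; have := size_subst_word (w k) t_gt1.
  by rewrite -subst_powS -/(w _); lia.
have w_nth k l i : i < size (w k) -> i < size (w l) -> nth a (w k) i = nth a (w l) i.
  move=> lt_k lt_l; case/orP: (leq_total k l) => /w_ext_le [v eq_v].
    by rewrite eq_v nth_cat lt_k.
  by rewrite eq_v nth_cat lt_l.
pose x i := nth a (w i) i.
have x_pre k : mkseq x (size (w k)) = w k.
  apply: (@eq_from_nth _ a); rewrite size_mkseq // => i lt_i.
  by rewrite nth_mkseq //; apply: w_nth.
exists x; split=> //; apply: functional_extensionality => i.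
have lt_i : i < size (subst_word t (mkseq x (size (w i)))).
  by rewrite x_pre -subst_powS ltnW // w_size.
rewrite (nth_subst_right t_gt0 a lt_i) x_pre -subst_powS -/(w _).
by apply: w_nth => //; apply: ltnW; apply: w_size.
Qed.

End ExpandingFixedPoints.

(** * Left-infinite fixed points by mirror image *)

Definition rev_subst n (t : subst n) : subst n := fun a => rev (t a).

(** A left-infinite sequence is indexed away from the origin, so reversing each block turns
    left-infinite fixed points into right-infinite ones. *)
Lemma subst_left_rev n (t : subst n) y : subst_left t y = subst_right (rev_subst t) y.
Proof.
have revE w : rev (subst_word t (rev w)) = subst_word (rev_subst t) w.
  elim: w => [//|a w IH]; rewrite rev_cons -cats1 subst_word_cat subst_word1 rev_cat IH.
  by rewrite -cat1s subst_word_cat subst_word1.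
by apply: functional_extensionality => i; rewrite /subst_left /subst_right revE.
Qed.

Lemma uniq_map_NoDup (T : Type) (A : eqType) (f : T -> A) (l : list T) :
  List.NoDup l -> (forall x y, List.In x l -> List.In y l -> f x = f y -> x = y) ->
  uniq (map f l).
Proof.
elim: l => //= x l IH nd inj; inversion nd as [|x' l' nx ndl]; subst.
rewrite IH ?andbT //; last by move=> y z ly lz; apply: inj; right.
apply/negP => fx; apply: nx; elim: l inj fx {IH nd ndl} => //= y l IH inj.
rewrite inE => /orP [/eqP eq_f | fx]; first by left; apply/esym/inj; auto.
by right; apply: IH => // u v [<-|lu] [<-|lv]; apply: inj => /=; auto.
Qed.

Lemma mem_map_In (T : Type) (A : eqType) (f : T -> A) (l : list T) a :
  a \in map f l <-> exists x, List.In x l /\ f x = a.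
Proof.
elim: l => [|x l IH] /=; first by split=> // -[? []].
rewrite inE; split=> [/orP [/eqP ->|/IH [y [ly <-]]] | [y [[->|ly] eq_a]]].
- by exists x; auto.
- by exists y; auto.
- by rewrite eq_a eqxx.
- by apply/orP; right; apply/IH; exists y.
Qed.

(** In the mirror image, a fixed point is determined by its first letter [a], and one exists exactly
    when the original block of [a] ends in [a]. *)
Lemma left_fixed_list n (t : subst n) : (forall a, 1 < size (t a)) ->
  exists ys : list (nat -> 'I_n), [/\ List.NoDup ys,
    List.length ys = #|[pred a | last a (t a) == a]| &
    forall y, List.In y ys <-> left_fixed t y].
Proof.
move=> t_gt1.
have rt_gt1 a : 1 < size (rev_subst t a) by rewrite size_rev.
have rt0 a : nth a (rev_subst t a) 0 = last a (t a).
  by rewrite nth_rev ?(ltnW (t_gt1 a)) // subn1 nth_last.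
have fixP y : left_fixed t y <-> right_fixed (rev_subst t) y.
  by rewrite /left_fixed subst_left_rev.
have ex a : exists y, last a (t a) = a -> left_fixed t y /\ y 0 = a.
  case: (classic (last a (t a) = a)) => [la|]; last by exists (fun=> a).
  have [|y [fy y0]] := @right_fixed_exists _ _ rt_gt1 a; first by rewrite rt0.
  by exists y => _; split=> //; apply/fixP.
have [lf lfP] := functional_choice _ ex.
pose L := enum [pred a | last a (t a) == a].
have L_lf a : a \in L -> left_fixed t (lf a) /\ lf a 0 = a.
  by rewrite mem_enum inE => /eqP /lfP.
exists (map lf L); split.
- rewrite /L; have := enum_uniq [pred a | last a (t a) == a].
  rewrite -/L; elim: L L_lf => [|a L IH] L_lf /=; first by constructor.
  case/andP=> naL uL; constructor; last by apply: IH => // b bL; apply: L_lf; rewrite inE bL orbT.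
  move=> lfa; case/negP: naL; have [_ <-] := L_lf a (mem_head _ _).
  elim: L lfa L_lf {IH uL} => //= b L IH [<- | lfa] L_lf.
    by rewrite (L_lf b _).2 ?mem_head // !inE eqxx orbT.
  rewrite inE IH ?orbT // => d; rewrite inE => dL; apply: L_lf.
  by move: dL; rewrite !inE => /orP [->|->]; rewrite ?orbT.
- by rewrite cardE -/L; elim: L {L_lf} => //= a L ->.
- move=> y; split=> [ly | fy].
    elim: L ly L_lf => //= a L IH [<- | ly] L_lf; first by apply: (L_lf a _).1; rewrite mem_head.
    by apply: IH => // b bL; apply: L_lf; rewrite inE bL orbT.
  have fry := (fixP y).1 fy.
  have la : last (y 0) (t (y 0)) = y 0.
    rewrite -rt0 -[RHS](congr1 (fun x => x 0) fry) subst_right1.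
      by rewrite (scat_lt (y 0)) // ltnW.
    by move=> a; apply: ltnW.
  have -> : y = lf (y 0).
    have [fl l0] := lfP _ la.
    by apply: (right_fixed_uniq rt_gt1 fry _ (esym l0)); apply/fixP.
  have: y 0 \in L by rewrite mem_enum inE la.
  elim: L {L_lf} => //= a L IH; rewrite inE => /orP [/eqP -> | /IH]; auto.
Qed.

(** * Choice of a power of the substitution *)

Lemma iter_idempotent (T : finType) (f : T -> T) B :
  exists J, B <= J /\ forall x, iter J f (iter J f x) = iter J f x.
Proof.
have [F FP] := nat_pigeonhole (fun k => [ffun x => iter k f x])
  (fun M => ex_intro (fun l => M <= l /\ True) M (conj (leqnn M) I)).
have [i [_ _ eqi]] := FP 0; have [j [lt_ij _ eqj]] := FP i.+1.
pose d := j - i.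
have per k x : i <= k -> iter (k + d) f x = iter k f x.
  move=> le_k; have -> : k + d = (k - i) + j by rewrite /d; lia.
  rewrite -[in RHS](subnK le_k) !iterD; congr iter.
  by have := congr1 (fun G : {ffun T -> T} => G x) (etrans eqj (esym eqi)); rewrite !ffunE.
have per_mul m k x : i <= k -> iter (k + m * d) f x = iter k f x.
  elim: m => [|m IH] le_k; first by rewrite addn0.
  by rewrite mulSnr addnA per ?IH // (leq_trans le_k) // leq_addr.
(* From [i] on, the iterates are periodic in the exponent with period [d]; this multiple of [d] is
   at least [i] and at least [B]. *)
exists ((i + B) * d); split=> [|x].
  by rewrite (leq_trans (leq_addl i B)) // leq_pmulr // subn_gt0.
rewrite -iterD per_mul // (leq_trans (leq_addr B i)) // leq_pmulr // subn_gt0.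
exact: lt_ij.
Qed.

Lemma last_subst_pow n (t : subst n) j a : nonerasing t ->
  last a (subst_pow t j a) = iter j (fun b => last b (t b)) a.
Proof.
move=> t_gt0; elim: j => // j IH; rewrite subst_powS /= -IH.
have := nonerasing_pow j t_gt0 a; case/lastP: (subst_pow t j a) => // w b _.
rewrite last_rcons -cats1 subst_word_cat subst_word1 last_cat.
by case: (t b) (t_gt0 b).
Qed.

Lemma head_subst_pow n (t : subst n) j a : nonerasing t -> nth a (t a) 0 = a ->
  nth a (subst_pow t j a) 0 = a.
Proof.
move=> t_gt0 ta; elim: j => // j IH; rewrite subst_powS.
have := nonerasing_pow j t_gt0 a; move: IH; case: (subst_pow t j a) => //= b w -> _.
by rewrite -cat1s subst_word_cat subst_word1 nth_cat t_gt0.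
Qed.

(** A high power is [t^K] of a word with at least two letters; every letter occurs in the first of
    these blocks, so before the last position of the whole. *)
Lemma subst_pow_interior n (t : subst n) : nonerasing t -> primitive t -> 1 < n ->
  exists B, forall j, B <= j -> forall a b, exists i,
    i.+1 < size (subst_pow t j b) /\ nth a (subst_pow t j b) i = a.
Proof.
move=> t_gt0 t_prim n_gt1.
have [K posK] := subst_pow_positive t_gt0 t_prim.
have [K' K'2] := subst_pow_size2 t_gt0 t_prim n_gt1.
exists (K + K') => j le_j a b.
have -> : j = K + (j - K) by lia.
have : 1 < size (subst_pow t (j - K) b) by apply: K'2; lia.
rewrite subst_powD; case: (subst_pow t (j - K) b) => [//|d [//|d' w]] _.
rewrite -cat1s subst_word_cat subst_word1 -cat1s subst_word_cat subst_word1.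
have da : a \in subst_pow t K d by apply: posK.
exists (index a (subst_pow t K d)).
rewrite nth_cat index_mem da nth_index //; split=> //.
have := nonerasing_pow K t_gt0 d'; have := da; rewrite -index_mem !size_cat => lt_i d'_gt0.
by have := leq_add lt_i d'_gt0; rewrite addn1 addnA => /ltn_addr ->.
Qed.

(** * Moving the cuts and coding two-letter words *)

Section TwoBlocks.
Variables (n N : nat) (enc : 'I_n -> 'I_n -> 'I_N) (dec : 'I_N -> 'I_n * 'I_n).
Variable X : (nat -> 'I_n) -> Prop.
Hypothesis X_sh : forall k x, X x -> X (sh k x).
Hypothesis encK : forall x, X x -> dec (enc (x 0) (x 1)) = (x 0, x 1).

Definition two_block (x : nat -> 'I_n) : nat -> 'I_N := fun i => enc (x i) (x i.+1).

Lemma sh_two_block k x : sh k (two_block x) = two_block (sh k x).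
Proof. by apply: functional_extensionality => i; rewrite /sh /two_block addnS. Qed.

Lemma dec_two_block x i : X x -> dec (two_block x i) = (x i, x i.+1).
Proof.
by move=> /(X_sh i) /encK; rewrite /sh addn0 addn1.
Qed.

Lemma two_block_inj x y : X x -> X y -> two_block x = two_block y -> x = y.
Proof.
move=> Xx Xy eq_b; apply: functional_extensionality => i.
by have := dec_two_block i Xx; rewrite eq_b dec_two_block // => -[].
Qed.

(** The two-letter word at the end of [w] straddles the border, so the coded block depends on [w]
    and on [x 0] only; the constant sequence supplies that letter. *)
Lemma two_block_scat w x : two_block (scat w x) =
  scat (mkseq (two_block (scat w (fun=> x 0))) (size w)) (two_block x).
Proof.
rewrite -[LHS](scat_mkseq _ (size w)) sh_two_block sh_scat_size; congr scat.
have eqi i : i <= size w -> scat w x i = scat w (fun=> x 0) i.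
  rewrite leq_eqVlt => /orP [/eqP -> | lt_i]; first by rewrite !scat_ge // subnn.
  by rewrite !(scat_lt (x 0)).
by apply/eq_mkseqP => i lt_i; rewrite /two_block !eqi // ltnW.
Qed.

Definition two_blocks (y : nat -> 'I_N) := exists x, X x /\ y = two_block x.

Lemma two_blocks_shift y : two_blocks y -> two_blocks (sh 1 y).
Proof.
by move=> [x [Xx ->]]; exists (sh 1 x); split; [exact: X_sh | exact: sh_two_block].
Qed.

Lemma two_blocks_closed : closed_set X -> closed_set two_blocks.
Proof.
move=> X_closed y yP.
have near L : exists x, X x /\ forall i, i < L -> two_block x i = y i.
  by have [_ [[x [Xx ->]] eq_x]] := yP L; exists x.
have decE x i : X x -> two_block x i = y i -> x i = (dec (y i)).1.
  by move=> Xx <-; rewrite dec_two_block.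
exists (fun i => (dec (y i)).1); split.
  apply: X_closed => L; have [x [Xx eq_x]] := near L; exists x; split=> // i lt_i.
  by apply: decE => //; apply: eq_x.
apply: functional_extensionality => i; have [x [Xx eq_x]] := near i.+2.
by rewrite -eq_x // /two_block -!(decE x) // eq_x.
Qed.

Section MovedCuts.
(* [t] with the boundary at the left of each block [t a] moved [c a] letters to
   the right, written on two-letter words: the block of [ab] then depends on
   [a] and [b] only. *)
Variables (t : subst n) (c : 'I_n -> nat).
Hypothesis t_gt0 : nonerasing t.
Hypothesis c_lt : forall a, (c a).+1 < size (t a).
Hypothesis X_subst : forall x, X x -> X (subst_right t x).
Hypothesis X_shift_surj : forall x, X x -> exists y, X y /\ sh 1 y = x.
(** A cut is moved only in front of points with a single preimage: the letters that a block cedes to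
    its predecessor then still determine this predecessor. *)
Hypothesis c_branch : forall x y, X x -> X y -> sh 1 x = sh 1 y -> 0 < c (x 1) -> x = y.
Hypothesis t_tower : tower t X.
Hypothesis dec_inj : injective dec.
Hypothesis dec_X : forall i, exists x, [/\ X x, x 0 = (dec i).1 & x 1 = (dec i).2].

Definition moved_right x := sh (c (x 0)) (subst_right t x).

Definition moved_block a b := drop (c a) (t a) ++ take (c b) (t b).

(** The letter at index [c b] in [t b] opens the following moved block; it completes the last
    two-letter word of the present one. *)
Definition moved_subst : subst N := fun i =>
  let: (a, b) := dec i in
  mkseq (two_block (scat (moved_block a b) (fun=> nth b (t b) (c b))))
    (size (moved_block a b)).

Lemma size_moved_block a b : size (moved_block a b) = size (t a) - c a + c b.
Proof. by rewrite size_cat size_drop size_takel // ltnW // ltnW. Qed.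

Lemma size_moved_subst i : size (moved_subst i) = size (moved_block (dec i).1 (dec i).2).
Proof. by rewrite /moved_subst; case: (dec i) => a b; rewrite size_mkseq. Qed.

Lemma moved_subst_gt1 i : 1 < size (moved_subst i).
Proof. by rewrite size_moved_subst size_moved_block; have := c_lt (dec i).1; lia. Qed.

Lemma moved_subst_gt0 : nonerasing moved_subst.
Proof. by move=> i; apply/ltnW/moved_subst_gt1. Qed.

Lemma moved_right0 x : moved_right x 0 = nth (x 0) (t (x 0)) (c (x 0)).
Proof. by rewrite /moved_right /sh addn0 (subst_right1 t_gt0) (scat_lt (x 0)) // ltnW. Qed.

(** Both letters lie in the block of [x 0], since at least two letters of it remain after the moved
    cut; this is what the successor in [c_lt] provides. *)
Lemma moved_right_next x y : x 0 = y 0 ->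
  moved_right x 0 = moved_right y 0 /\ moved_right x 1 = moved_right y 1.
Proof.
move=> eq0; rewrite !moved_right0 eq0; split=> //.
rewrite /moved_right /sh !addn1 (subst_right1 t_gt0 x) (subst_right1 t_gt0 y) eq0.
by rewrite !(scat_lt (x 0)).
Qed.

Lemma moved_rightE x :
  moved_right x = scat (moved_block (x 0) (x 1)) (moved_right (sh 1 x)).
Proof.
rewrite /moved_right (subst_right1 t_gt0) sh_scat; last by rewrite ltnW // ltnW.
rewrite scat_cat; congr scat.
rewrite -[LHS](scat_mkseq _ (c (x 1))); congr scat.
by rewrite (subst_right1 t_gt0) mkseq_scat_take // ltnW // ltnW.
Qed.

Lemma X_moved_right x : X x -> X (moved_right x).
Proof. by move=> /X_subst; apply: X_sh. Qed.

Lemma subst_right_moved x : X x ->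
  subst_right moved_subst (two_block x) = two_block (moved_right x).
Proof.
apply: (@subst_right_coind _ _ moved_subst_gt0 _ X two_block
  (fun x => two_block (moved_right x))) => {}x; first exact: X_sh.
  by rewrite sh_two_block.
move=> Xx; rewrite {1}moved_rightE two_block_scat; congr scat.
by rewrite /moved_subst dec_two_block // moved_right0.
Qed.

Lemma two_blocks_subst y : two_blocks y -> two_blocks (subst_right moved_subst y).
Proof.
move=> [x [Xx ->]]; exists (moved_right x); split; first exact: X_moved_right.
exact: subst_right_moved.
Qed.

Lemma two_blocks_next x y : two_blocks x -> two_blocks y -> x 0 = y 0 ->
  subst_right moved_subst (sh 1 x) 0 = subst_right moved_subst (sh 1 y) 0.
Proof.
move=> [x' [Xx ->]] [y' [Xy ->]] eq0.
have eq1 : x' 1 = y' 1.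
  by have := dec_two_block 0 Xx; rewrite eq0 dec_two_block // => -[].
rewrite !sh_two_block !subst_right_moved; [|exact: X_sh | exact: X_sh].
have [e0 e1] := @moved_right_next (sh 1 x') (sh 1 y') eq1.
by rewrite /two_block e0 e1.
Qed.

Lemma two_blocks_letter i : exists y, two_blocks y /\ y 0 = i.
Proof.
have [x [Xx x0 x1]] := dec_X i; exists (two_block x); split; first by exists x.
by apply: dec_inj; rewrite dec_two_block // x0 x1; case: (dec i).
Qed.

Lemma desubst_moved x s : X x -> s < size (moved_block (x 0) (x 1)) ->
  exists z e, [/\ X z, e < size (t (z 0)),
    sh s (moved_right x) = sh e (subst_right t z) &
    z = x /\ e = c (x 0) + s \/
    [/\ z = sh 1 x, size (t (x 0)) + e = c (x 0) + s & e < c (z 0)]].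
Proof.
move=> Xx; rewrite size_moved_block => lt_s; have lt_c0 := c_lt (x 0).
have lt_c1 := c_lt (x 1).
case: (ltnP (c (x 0) + s) (size (t (x 0)))) => [lt_e | ge_e].
  by exists x, (c (x 0) + s); split=> //; [rewrite shD | left].
exists (sh 1 x), (c (x 0) + s - size (t (x 0))); split.
- exact: X_sh.
- by rewrite -?[sh 1 x 0]/(x 1); lia.
- rewrite /moved_right shD -{1}(subnKC ge_e) -shD (subst_right1 t_gt0 x).
  by rewrite sh_scat_size.
- by right; split=> //; rewrite -?[sh 1 x 0]/(x 1); lia.
Qed.

Lemma tower_moved : tower moved_subst two_blocks.
Proof.
have [ex uq] := t_tower.
have sz x : X x -> size (moved_subst (two_block x 0)) = size (moved_block (x 0) (x 1)).
  by move=> Xx; rewrite size_moved_subst dec_two_block.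
split=> [_ [y [Xy ->]] | _ _ s s' [x [Xx ->]] [x' [Xx' ->]]].
  have [z [e [Xz lt_e ->]]] := ex y Xy.
  (* Offsets before the moved cut now belong to the block of the preceding letter, so a preimage of
     [z] under the shift is needed. *)
  case: (leqP (c (z 0)) e) => [le_c | lt_c].
    exists (two_block z), (e - c (z 0)); split; first by exists z.
      by rewrite sz // size_moved_block; lia.
    by rewrite subst_right_moved // sh_two_block shD subnKC.
  have [x [Xx eq_z]] := X_shift_surj Xz.
  have x1 : x 1 = z 0 by rewrite -eq_z.
  exists (two_block x), (size (t (x 0)) - c (x 0) + e); split; first by exists x.
    by rewrite sz // size_moved_block x1; lia.
  rewrite subst_right_moved // sh_two_block shD addnA.
  rewrite subnKC; last by have := c_lt (x 0); lia.
  by rewrite -shD (subst_right1 t_gt0 x) sh_scat_size eq_z.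
rewrite !sz // => lt_s lt_s'; rewrite !subst_right_moved // !sh_two_block.
move/two_block_inj => eq_sh.
have {}eq_sh := eq_sh (X_sh _ (X_moved_right Xx)) (X_sh _ (X_moved_right Xx')).
have [z [e [Xz lt_e eqx zx]]] := desubst_moved Xx lt_s.
have [z' [e' [Xz' lt_e' eqx' zx']]] := desubst_moved Xx' lt_s'.
rewrite eqx eqx' in eq_sh.
have [eq_z eq_e] := uq _ _ _ _ Xz Xz' lt_e lt_e' eq_sh; subst z' e'.
(* In the mixed cases one offset is both at least and less than [c] of the same letter. When both
   positions lie in ceded letters, [x] and [x'] have the same tail, and [c_branch] identifies
   them. *)
case: zx zx' => [[-> ->] | [-> se lt_c]] [[eq_x' eq_e] | [eq_x' se' lt_c']].
- by rewrite -eq_x' in eq_e *; split=> //; apply: (@addnI (c (x 0))).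
- by move: lt_c'; rewrite ltnNge leq_addr.
- by move: lt_c; rewrite eq_e eq_x' ltnNge leq_addr.
have eq_x : x = x' by apply: c_branch => //; apply: leq_ltn_trans lt_c.
by rewrite eq_x in se *; split=> //; apply: (@addnI (c (x' 0))); rewrite -se -se'.
Qed.

Lemma dec_last_moved i : dec (last i (moved_subst i)) =
  (last (dec i).1 (moved_block (dec i).1 (dec i).2),
   nth (dec i).2 (t (dec i).2) (c (dec i).2)).
Proof.
have [x [Xx x0 x1]] := dec_X i.
have eq_i : i = two_block x 0.
  by apply: dec_inj; rewrite dec_two_block // x0 x1; case: (dec i).
have sz : size (moved_subst i) = size (moved_block (x 0) (x 1)).
  by rewrite size_moved_subst x0 x1.
have sz_gt1 := moved_subst_gt1 i; rewrite sz in sz_gt1.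
have XT := X_moved_right Xx.
have -> : last i (moved_subst i) =
    two_block (moved_right x) (size (moved_block (x 0) (x 1))).-1.
  rewrite -subst_right_moved // (subst_right1 moved_subst_gt0) -eq_i.
  rewrite (scat_lt i) ?sz ?prednK ?(ltnW sz_gt1) // -sz nth_last.
  by case: (moved_subst i).
rewrite dec_two_block // prednK ?(ltnW sz_gt1) // moved_rightE -x0 -x1; congr pair.
  rewrite (scat_lt (x 0)) ?prednK ?(ltnW sz_gt1) // nth_last.
  by case: (moved_block _ _) sz_gt1.
by rewrite scat_ge // subnn moved_right0.
Qed.

End MovedCuts.
End TwoBlocks.

(** * Preimages of fixed points *)

Lemma right_fixed_head n (t : subst n) x : nonerasing t -> right_fixed t x ->
  nth (x 0) (t (x 0)) 0 = x 0.
Proof.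
move=> t_gt0 fx; have := congr1 (fun y => y 0) fx.
by rewrite (subst_right1 t_gt0) (scat_lt (x 0)).
Qed.

(** Commuting with its power, [t] maps a fixed point of [t^J] to a fixed point of [t^J]; the first
    letter is kept, so by uniqueness the point is the same. *)
Lemma right_fixed_letter n (t : subst n) J b : nonerasing t ->
  (forall a, 1 < size (subst_pow t J a)) -> nth b (t b) 0 = b ->
  exists x, right_fixed t x /\ x 0 = b.
Proof.
move=> t_gt0 tJ_gt1 tb.
have [x [fx x0]] := right_fixed_exists tJ_gt1 (head_subst_pow J t_gt0 tb).
exists x; split=> //; apply: (right_fixed_uniq tJ_gt1) => //.
  have comm j : subst_right (subst_pow t j) (subst_right t x) =
      subst_right t (subst_right (subst_pow t j) x).
    elim: j => [|j IH]; first by rewrite !subst_right_pow0.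
    by rewrite !subst_right_powS // IH.
  by rewrite /right_fixed comm fx.
by rewrite (subst_right1 t_gt0) x0 (scat_lt b) ?tb.
Qed.

Section LeftExtensions.
Variables (n : nat) (t : subst n) (X : (nat -> 'I_n) -> Prop).
Hypothesis X_closed : closed_set X.
Hypothesis X_sh : forall k x, X x -> X (sh k x).
Hypothesis X_subst : forall x, X x -> X (subst_right t x).
Hypothesis t_gt1 : forall a, 1 < size (t a).
Hypothesis t_tower : tower t X.

Let t_gt0 : nonerasing t. Proof. by move=> a; apply: ltnW. Qed.

Let last_image x := sh (size (t (x 0))).-1 (subst_right t x).

Lemma last_image0 x : last_image x 0 = last (x 0) (t (x 0)).
Proof.
rewrite /last_image /sh addn0 (subst_right1 t_gt0) (scat_lt (x 0)) ?nth_last //.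
by rewrite prednK.
Qed.

Lemma sh_last_image x : sh 1 (last_image x) = subst_right t (sh 1 x).
Proof. by rewrite shD addn1 prednK // (subst_right1 t_gt0 x) sh_scat_size. Qed.

Lemma eq_head_tail (x y : nat -> 'I_n) : x 0 = y 0 -> sh 1 x = sh 1 y -> x = y.
Proof.
move=> eq0 eq1; apply: functional_extensionality => -[//|i].
exact: (congr1 (fun z => z i) eq1).
Qed.

(* [last_image] acts on the preimages of a fixed point; it is injective by unique
   desubstitution and idempotent by assumption, hence the identity. *)
Lemma preimage_last_fixed p y : right_fixed t p ->
  (forall a, let b := last a (t a) in last b (t b) = b) ->
  X y -> sh 1 y = p -> last (y 0) (t (y 0)) = y 0.
Proof.
move=> p_fixed last_idem Xy y1.
have Xy' : X (last_image y) by apply/X_sh/X_subst.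
have last1 z : sh 1 z = p -> sh 1 (last_image z) = p.
  by move=> z1; rewrite sh_last_image z1.
have eq_im : last_image (last_image y) = last_image y.
  apply: eq_head_tail; last by rewrite !last1 // last1.
  by rewrite last_image0 last_image0 last_idem.
have lt_im z : (size (t (z 0))).-1 < size (t (z 0)) by rewrite prednK.
have [<- _] := t_tower.2 _ _ _ _ Xy' Xy (lt_im _) (lt_im _) eq_im.
by rewrite last_image0 last_idem.
Qed.

(** Starting from [x], the map [last_image] keeps the first letter and lengthens the agreement of
    the tail with [p]; the limit is in [X] because [X] is closed. *)
Lemma preimage_exists p x : right_fixed t p -> X x -> x 1 = p 0 ->
  last (x 0) (t (x 0)) = x 0 -> exists y, [/\ X y, y 0 = x 0 & sh 1 y = p].
Proof.
move=> p_fixed Xx x1 last_x.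
have approx l : exists y, [/\ X y, y 0 = x 0 & forall i, i <= l -> y i.+1 = p i].
  elim: l => [|l [y [Xy y0 yl]]]; first by exists x; split=> // -[].
  exists (last_image y); split; first exact/X_sh/X_subst.
    by rewrite last_image0 y0.
  move=> i le_i; rewrite -[LHS]/(sh 1 (last_image y) i) sh_last_image -p_fixed.
  have lt_i z : i < size (subst_word t (mkseq z l.+1)).
    have := size_subst_word (mkseq z l.+1) t_gt1; rewrite size_mkseq; lia.
  rewrite !(nth_subst_right t_gt0 (x 0) (lt_i _)); congr nth; congr subst_word.
  by apply/eq_mkseqP => j lt_j; apply: yl.
exists (scat [:: x 0] p); split=> //; last exact: (sh_scat_size [:: x 0]).
apply: X_closed => L; have [y [Xy y0 yL]] := approx L; exists y; split=> //.
move=> [|i] lt_i //; rewrite scat_ge //= subn1; apply: yL.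
by apply/ltnW/ltnW.
Qed.

End LeftExtensions.

Lemma two_letter_coding n (P : seq 'I_n -> Prop) (s : seq (seq 'I_n)) (a0 b0 : 'I_n) :
  uniq s -> (forall w, w \in s <-> size w = 2 /\ P w) -> P [:: a0; b0] ->
  exists (dec : 'I_(size s) -> 'I_n * 'I_n) (enc : 'I_n -> 'I_n -> 'I_(size s)),
    [/\ injective dec, forall i, P [:: (dec i).1; (dec i).2] &
        forall a b, P [:: a; b] -> dec (enc a b) = (a, b)].
Proof.
move=> s_uniq sP P0.
pose dec (i : 'I_(size s)) := (nth a0 (nth [::] s i) 0, nth a0 (nth [::] s i) 1).
have decE (i : 'I_(size s)) : nth [::] s i = [:: (dec i).1; (dec i).2].
  have [+ _] := (sP (nth [::] s i)).1 (mem_nth _ (ltn_ord i)).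
  by rewrite /dec; case: (nth _ _ _) => [|a [|b []]].
have s_word a b : P [:: a; b] -> [:: a; b] \in s by move=> Pab; apply/sP.
have ex ab : exists i, P [:: ab.1; ab.2] -> dec i = ab.
  case: (classic (P [:: ab.1; ab.2])) => [Pab | nP]; last first.
    have := s_word _ _ P0; rewrite -index_mem => lt_i.
    by exists (Ordinal lt_i).
  have in_s := s_word _ _ Pab; have := in_s; rewrite -index_mem => lt_i.
  by exists (Ordinal lt_i) => _; rewrite /dec /= nth_index //=; case: (ab).
have [f fP] := functional_choice _ ex.
exists dec, (fun a b => f (a, b)); split=> [i j eq_ij | i | a b Pab].
- apply/val_inj/eqP; rewrite -(nth_uniq [::] (ltn_ord i) (ltn_ord j) s_uniq).
  by rewrite !decE eq_ij.
- by rewrite -decE; apply: ((sP _).1 _).2; apply: mem_nth.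
- exact: (fP (a, b)).
Qed.

(** * Construction of [tau'] and count of its fixed points *)

Theorem theorem20 (n : nat) (tau : subst n) (m : nat)
  (p : 'I_m -> nat -> 'I_n) (k : 'I_m -> nat) (N : nat) :
  nonerasing tau ->
  primitive tau ->
  infinite_set (Xsub tau) ->
  unilat_recognizable tau ->
  injective_powers tau ->
  injective p ->
  (forall i, right_fixed tau (p i)) ->
  (forall x, right_fixed tau x -> exists i, x = p i) ->
  (forall i, k_branch_point (Xsub tau) (p i) (k i)) ->
  (forall x, branch_point (Xsub tau) x -> exists i, x = p i) ->
  (exists s : seq (seq 'I_n), uniq s /\ size s = N /\
     forall w, w \in s <-> (size w = 2 /\ lang tau w)) ->
  exists tau' : subst N,
    nonerasing tau' /\
    topo_conj (Xsub tau) shift (Xsub tau') shift /\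
    (exists q : 'I_m -> nat -> 'I_N, injective q /\
       (forall i, right_fixed tau' (q i)) /\
       (forall x, right_fixed tau' x -> exists i, x = q i)) /\
    (exists ys : list (nat -> 'I_N), List.NoDup ys /\
       List.length ys = (\sum_(i < m) k i)%N /\
       forall y, List.In y ys <-> left_fixed tau' y) /\
    (exists F : (nat -> edge N) -> (nat -> edge N),
       (forall x, bpath tau' x -> bpath tau' (F x)) /\
       (forall x, bpath tau' x -> nonmaximal tau' x -> vershik_rel tau' x (F x)) /\
       cont_on (bpath tau') F /\
       topo_conj (Xsub tau') shift (bpath tau') F).
Proof.
move=> tau_gt0 tau_prim X_inf tau_rec tau_inj p_inj p_fixed p_all p_branch branch_p.
move=> [s [s_uniq [<- sP]]].
set X := Xsub tau in X_inf p_branch branch_p *.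
have n_gt1 := infinite_alphabet X_inf.
have tau_inj1 : injective tau.
  by move=> a b eq_ab; apply: (tau_inj 1); rewrite /subst_pow /= !subst_word1.
have [i0 _] : exists i0 : 'I_m, True.
  apply: NNPP => no_i; apply: X_inf; exists nil => x [u [/p_all [i _] _]].
  by case: no_i; exists i.
have branch_fixed x : branch_point X x -> right_fixed tau x.
  by move=> /branch_p [i ->].
have X_occurs x l i : X x -> exists r, forall j, j < l -> sh r (p i) j = x j.
  by move=> Xx; have [r [_ rP]] := Xsub_occurs tau_gt0 tau_prim n_gt1 (p_fixed i) l Xx; exists r.
have X_closed : closed_set X := Xsub_closed tau_gt0 tau_prim n_gt1 (p_fixed i0).
have X_sh r x : X x -> X (sh r x).
  exact: (Xsub_sh tau_gt0 tau_prim n_gt1 (p_fixed i0)).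
have X_p i : X (p i) := Xsub_fixed tau_gt0 tau_prim n_gt1 (p_fixed i).
have X_surj := Xsub_shift_surj tau_gt0 tau_prim n_gt1 (p_fixed i0).
have X_tau := Xsub_subst tau_gt0 tau_prim n_gt1 (p_fixed i0).
have tow := tower_Xsub tau_gt0 tau_prim X_inf (p_fixed i0) tau_rec tau_inj1 branch_fixed.
have [B1 gt1P] := subst_pow_size2 tau_gt0 tau_prim n_gt1.
have [B2 interiorP] := subst_pow_interior tau_gt0 tau_prim n_gt1.
(* [B1] makes all blocks of length at least 2, [B2] puts every letter at a position before the last
   in each block. *)
have [J [le_J idemJ]] := iter_idempotent (fun b => last b (tau b)) (B1 + B2).
pose theta := subst_pow tau J.
have theta_gt0 : nonerasing theta by apply: nonerasing_pow.
have theta_gt1 a : 1 < size (theta a) by apply: gt1P; lia.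
have X_theta x : X x -> X (subst_right theta x).
  exact: (Xsub_subst_pow tau_gt0 tau_prim n_gt1 (p_fixed i0) J).
have tow_theta : tower theta X by apply: tower_pow.
have p_theta i : right_fixed theta (p i) by apply: right_fixed_pow.
have last_idem a : let b := last a (theta a) in last b (theta b) = b.
  by rewrite /= !last_subst_pow // idemJ.
(* These letters turn out to be exactly the first letters of the [p i]. *)
pose fixl b := nth b (tau b) 0 == b.
have fixl_p i : fixl (p i 0) by apply/eqP/right_fixed_head.
have fixlP b : fixl b -> exists i, p i 0 = b.
  move=> /eqP tau_b.
  have [x [/p_all [i ->] x0]] := right_fixed_letter tau_gt0 theta_gt1 tau_b.
  by exists i.
have p0_inj i j : p i 0 = p j 0 -> i = j.
  by move=> eq0; apply: p_inj; apply: (right_fixed_uniq theta_gt1).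
(* The cut stays at the start of the block for the letters in [fixl] and moves to an occurrence of
   [p i0 0] for all others. *)
have ex_c b : exists c, c.+1 < size (theta b) /\
    (if fixl b then c = 0 else nth b (theta b) c = p i0 0).
  case: (boolP (fixl b)) => [_ | _]; first by exists 0.
  have [|c [lt_c nth_c]] := interiorP J _ (p i0 0) b; first by lia.
  by exists c; split=> //; rewrite -[RHS]nth_c; apply/set_nth_default/ltnW.
have [c cP] := functional_choice _ ex_c.
have c_lt a : (c a).+1 < size (theta a) by case: (cP a).
have c_fixl b : fixl b -> c b = 0 by move=> fb; case: (cP b); rewrite fb.
(* For [b] outside [fixl], the moved block opens with [p i0 0], which is in [fixl] and so differs
   from [b]: no fixed point of [tau'] can start with a word that begins with [b]. *)
have nth_c b : (nth b (theta b) (c b) == b) = fixl b.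
  case: (boolP (fixl b)) => fb.
    by rewrite c_fixl //; apply/eqP/head_subst_pow/eqP.
  case: (cP b) => _; rewrite (negbTE fb) => ->; apply/negP => /eqP eq_b.
  by case/negP: fb; rewrite -eq_b.
have p_lang : lang tau [:: p i0 0; p i0 1] := lang_right_fixed tau_gt0 tau_prim n_gt1 2 (p_fixed i0).
have [dec [enc [dec_inj dec_lang encK]]] := two_letter_coding s_uniq sP p_lang.
have X_encK x : X x -> dec (enc (x 0) (x 1)) = (x 0, x 1).
  move=> /(Xsub_langP tau_gt0 tau_prim n_gt1 (p_fixed i0)) /(_ 2) x_lang.
  exact: encK.
have dec_X i : exists x, [/\ X x, x 0 = (dec i).1 & x 1 = (dec i).2].
  exact: (Xsub_word2 tau_gt0 tau_prim n_gt1 (p_fixed i0)).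
have c_branch x y : X x -> X y -> sh 1 x = sh 1 y -> 0 < c (x 1) -> x = y.
  move=> Xx Xy eq1 c_gt0; apply: NNPP => neq; move: c_gt0.
  have /branch_p [i eq_i] : branch_point X (sh 1 x).
    by split; [exact: X_sh | exists x, y].
  have -> : x 1 = p i 0 by rewrite -eq_i.
  by rewrite c_fixl.
pose tau' := moved_subst enc dec theta c.
pose q i := two_block enc (p i).
have tau'_gt1 : forall i, 1 < size (tau' i) by exact: moved_subst_gt1.
have decB x i : X x -> dec (two_block enc x i) = (x i, x i.+1).
  exact: (dec_two_block X_sh X_encK).
have tau'E x : X x -> subst_right tau' (two_block enc x) = two_block enc (moved_right theta c x).
  exact: (subst_right_moved X_sh X_encK theta_gt0 c_lt).
have moved_p i : moved_right theta c (p i) = p i.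
  by rewrite /moved_right c_fixl // p_theta.
have q_fixed i : right_fixed tau' (q i) by rewrite /right_fixed tau'E // moved_p.
have enc_dec x i : X x -> x 0 = (dec i).1 -> x 1 = (dec i).2 -> two_block enc x 0 = i.
  by move=> Xx x0 x1; apply: dec_inj; rewrite decB // x0 x1; case: (dec i).
(* If [y 0] codes [ab], being fixed forces [a] to open its own moved block, so [a] is the first
   letter of some [p i]; [moved_right_next] then forces [b] to be the second. *)
have q_all y : right_fixed tau' y -> exists i, y = q i.
  move=> fy; have [x [Xx x0 x1]] := dec_X (y 0).
  have eq_y0 := enc_dec _ _ Xx x0 x1.
  have : dec (two_block enc (moved_right theta c x) 0) = dec (two_block enc x 0).
    rewrite -tau'E // (@subst_right_agree _ _ _ y 0) ?fy ?eq_y0 //.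
    by move=> j; rewrite leqn0 => /eqP ->.
  rewrite !decB //; last exact: X_moved_right.
  case=> m0 m1; have /fixlP [i pi0] : fixl (x 0).
    by rewrite -nth_c -moved_right0 // m0.
  have [_ m1'] := moved_right_next theta_gt0 c_lt pi0.
  rewrite moved_p m1 in m1'.
  by exists i; apply: (right_fixed_uniq tau'_gt1) => //; rewrite -eq_y0 /q /two_block pi0 m1'.
have XsubE : Xsub tau' = two_blocks enc X.
  apply: functional_extensionality => y; apply: propositional_extensionality; split.
    move=> [v [/q_all [i ->] vy]].
    apply: (two_blocks_closed X_sh X_encK X_closed) => L; have [r rP] := vy L.
    exists (sh r (q i)); split; last by move=> j /rP.
    by exists (sh r (p i)); split; [exact: X_sh | exact: sh_two_block].
  move=> [x [Xx ->]]; exists (q i0); split=> // L.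
  have [r rP] := X_occurs x L.+1 i0 Xx; exists r => j lt_j.
  by rewrite /q /two_block -(rP j) ?ltnS ?(ltnW lt_j) // -(rP j.+1) // /sh addnS.
(* So left-infinite fixed points of [tau'] correspond to words [ab] such that [b] opens some [p i]
   and [theta a] ends in [a]. *)
have last_tau' i : (last i (tau' i) == i) =
    fixl (dec i).2 && (last (dec i).1 (theta (dec i).1) == (dec i).1).
  rewrite -(inj_eq dec_inj) (dec_last_moved X_sh X_encK theta_gt0 c_lt X_theta dec_inj dec_X).
  case: (dec i) => a b; rewrite xpair_eqE nth_c andbC /=.
  case: (boolP (fixl b)) => // fb; congr (_ == _).
  rewrite /moved_block (c_fixl b) // take0 cats0.
  rewrite -[in RHS](cat_take_drop (c a) (theta a)) last_cat.
  have : 0 < size (drop (c a) (theta a)) by rewrite size_drop subn_gt0 ltnW.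
  by case: (drop _ _).
(* A preimage [y] of [p j] is matched with its first two-letter word: distinct preimages differ in
   the first letter, and every admissible word comes from one by [preimage_exists]. *)
have card_preimages j :
    #|[pred a | (last a (tau' a) == a) && ((dec a).2 == p j 0)]| = k j.
  have [_ [ys [ys_nd [<- ysP]]]] := p_branch j.
  pose L := map (fun y => two_block enc y 0) ys.
  have uniq_L : uniq L.
    apply: uniq_map_NoDup => // x y /ysP [Xx x1] /ysP [Xy y1] eq_xy.
    apply: eq_head_tail; last by rewrite -!shiftE x1 y1.
    by have := decB x 0 Xx; rewrite eq_xy decB // => -[].
  have -> : List.length ys = size L by rewrite size_map.
  rewrite -(card_uniqP uniq_L); apply: eq_card => a.
  rewrite !inE last_tau'; apply/andP/idP.
    case=> /andP [fa /eqP last_a] /eqP a2; apply/mem_map_In.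
    have [x [Xx x0 x1]] := dec_X a.
    rewrite -x0 in last_a; rewrite -x1 in a2.
    have [y [Xy y0 y1]] := preimage_exists X_closed X_sh X_theta theta_gt1 (p_theta j) Xx a2 last_a.
    exists y; split; first by apply/ysP.
    by apply: enc_dec; rewrite // ?y0 // -[y 1]/(sh 1 y 0) y1 -a2.
  move/mem_map_In => [y [/ysP [Xy y1] <-]]; rewrite decB //=.
  have -> : y 1 = p j 0 by rewrite -y1.
  rewrite fixl_p eqxx; split=> //; apply/eqP.
  exact: (preimage_last_fixed X_sh X_theta theta_gt1 tow_theta (p_theta j)).
exists tau'; split; first by move=> i; apply: ltnW.
rewrite XsubE; split.
  exists (two_block enc), (fun y i => (dec (y i)).1).
  have decBK x : X x -> (fun i => (dec (two_block enc x i)).1) = x.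
    by move=> Xx; apply: functional_extensionality => i; rewrite decB.
  split=> [x Xx|]; first by exists x.
  split=> [_ [x [Xx ->]]|]; first by rewrite decBK.
  split; first exact: decBK.
  split=> [_ [x [Xx ->]]|]; first by rewrite decBK.
  split=> [x _ l|].
    by exists l.+1 => y _ eq_y i lt_i; rewrite /two_block !eq_y // ltnW.
  split=> [x _ l|x _]; first by exists l => y _ eq_y i lt_i; rewrite eq_y.
  exact: (esym (sh_two_block enc 1 x)).
split.
  exists q; split=> [i j eq_ij|]; last by split.
  exact: p_inj (two_block_inj X_sh X_encK (X_p i) (X_p j) eq_ij).
split.
  have [ys [ys_nd ys_len ysP]] := left_fixed_list tau'_gt1.
  exists ys; split=> //; split=> //.
  (* Letters are grouped by the fixed point that their second component opens. On the letters
     counted, such a fixed point exists and is unique; [i0] makes [idx] total. *)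
  pose idx a := odflt i0 [pick j | p j 0 == (dec a).2].
  rewrite ys_len -sum1_card (partition_big idx xpredT) //=; apply: eq_bigr => j _.
  rewrite sum1_card -card_preimages; apply: eq_card => a; rewrite !inE.
  apply: andb_id2l => la; rewrite /idx.
  have /andP [fa _] : fixl (dec a).2 && (last (dec a).1 (theta (dec a).1) == (dec a).1).
    by rewrite -last_tau'.
  case: pickP => [i /eqP pi0 | no_i]; last first.
    by have [i pi0] := fixlP _ fa; have := no_i i; rewrite pi0 eqxx.
  by rewrite -pi0 /=; apply/eqP/eqP => [-> | /p0_inj].
apply: bratteli_vershik_conj => //.
- exact: (two_blocks_closed X_sh X_encK X_closed).
- exact: two_blocks_shift.
- exact: (two_blocks_subst X_sh X_encK theta_gt0 c_lt X_theta).
- exact: (two_blocks_letter X_sh X_encK dec_inj dec_X).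
- exact: (tower_moved X_sh X_encK theta_gt0 c_lt X_theta X_surj c_branch tow_theta).
- exact: (two_blocks_next X_sh X_encK theta_gt0 c_lt).
Qed.
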